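(* Let $T=U|T|$ be the polar decomposition of an invertible centered operator $T\in\mathcal{B}(H)$, and let $\mathfrak{m}_f$ be an operator mean with representing function $f$ such that, with $\lambda=f'(1)\in(0,1)$, $$[1-\lambda+\lambda t^{-1}]^{-1}\le f(t)\le 1-\lambda+\lambda t\qquad\text{for all } t>0.$$ If $T$ is semi-hyponormal, then $$\lim_{n\to\infty}\Delta_f^n(T)=UL,\qquad\text{where } L:=\lim_{n\to\infty}U^{*n}|T|U^n .$$
   Context: $H$ is a complex Hilbert space, $\mathcal{B}(H)$ the bounded linear operators on $H$, $\mathcal{B}(H)_{++}$ the positive invertible ones, $|T|=(T^*T)^{1/2}$. All limits of operators are in the strong operator topology. If $T$ is invertible, $U$ in $T=U|T|$ is unitary. $T$ is semi-hyponormal if $|T^*|\le|T|$; in that case the sequence $U^{*n}|T|U^n$ is increasing and bounded by $\|T\|I$, so the strong limit $L$ exists. Operator mean: $\mathfrak{m}_f$ corresponds to a representing function $f:(0,\infty)\to(0,\infty)$, operator monotone with $f(1)=1$; for $A,B\in\mathcal{B}(H)_{++}$, $\mathfrak{m}_f(A,B)=A^{1/2}f(A^{-1/2}BA^{-1/2})A^{1/2}$. Induced Aluthge transformation: for invertible $T=U|T|$ with spectral decomposition $|T|=\int_{\sigma(|T|)}s\,dE_s$, define $\Delta_f(T):=\int_{\sigma(|T|)}\int_{\sigma(|T|)} s f(t/s)\,dE_s\,U\,dE_t$ (double operator integral). Concretely (known fact), if $\mu$ is a probability measure on $[0,1]$ with $f(x)=\int_0^1[1-\lambda+\lambda x^{-1}]^{-1}d\mu(\lambda)$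 for $x>0$ (such $\mu$ exists), then $\Delta_f(T)=\int_0^1\int_0^\infty e^{-(1-\lambda)s|T|^{-1}}\,U\,e^{-\lambda s|T|^{-1}}\,ds\,d\mu(\lambda)$. Iterates: $\Delta_f^0(T)=T$, $\Delta_f^n(T)=\Delta_f(\Delta_f^{n-1}(T))$. $T=U|T|$ is centered if $\{U^{*m}|T|U^m,\ |T|,\ U^n|T|U^{*n}: n,m=1,2,\dots\}$ is a commuting set. *)

(* Defs.v *)
From HB Require Import structures.
From mathcomp Require Import all_boot all_order all_algebra sesquilinear.
From mathcomp Require Import all_classical all_reals all_analysis.
From mathcomp Require Import complex.

Set Implicit Arguments.
Unset Strict Implicit.
Unset Printing Implicit Defensive.

Import Order.TTheory GRing.Theory Num.Theory.
Import numFieldNormedType.Exports.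

Local Open Scope classical_set_scope.
Local Open Scope complex_scope.
Local Open Scope ring_scope.

(* The inner product is linear in its first argument. *)
Record hilbertSpace (R : realType) := HilbertSpace {
  hcarrier :> completeNormedModType R[i] ;
  hdot : {dot hcarrier for (@Num.conj R[i])} ;
  hnormE : forall x : hcarrier, `|x| ^+ 2 = hdot x x }.

Section Operators.
Variables (R : realType) (H : hilbertSpace R).

Local Notation "''[' u , v ]" := (hdot H u v) : ring_scope.

Implicit Types A B S T U X : H -> H.

Definition BH : set (H -> H) := [set A | linear A /\ continuous A].

Definition invertible A :=
  BH A /\ exists2 B, BH B & A \o B = id /\ B \o A = id.

(* The order of R[i] is partial: [0 <= z] says that z is real and nonnegative,
   so a positive operator is self-adjoint. *)
Definition positive A := BH A /\ forall x, 0 <= '[A x, x].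

Definition BHpp : set (H -> H) := [set A | positive A /\ invertible A].

Definition ople A B := forall x, '[A x, x] <= '[B x, x].

Definition adj A : H -> H :=
  xget (fun=> 0) [set B | BH B /\ forall x y, '[A x, y] = '[x, B y]].

Definition opsqrt A : H -> H :=
  xget (fun=> 0) [set S | positive S /\ S \o S = A].

Definition opabs T : H -> H := opsqrt (adj T \o T).

Definition polar_decomposition T U :=
  [/\ BH U, T = U \o opabs T, U \o adj U \o U = U
    & forall x, U x = 0 <-> T x = 0].

Definition semi_hyponormal T := ople (opabs (adj T)) (opabs T).

Definition centered_family T U : set (H -> H) :=
  [set opabs T]
  `|` [set A | exists2 m, (0 < m)%N & A = iter m (adj U) \o opabs T \o iter m U]
  `|` [set A | exists2 n, (0 < n)%N & A = iter n U \o opabs T \o iter n (adj U)].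

(* U is meant to be the partial isometry of the polar decomposition of T. *)
Definition centered T U :=
  forall A B, centered_family T U A -> centered_family T U B -> A \o B = B \o A.

Definition strong_cvg (A : nat -> H -> H) (L : H -> H) :=
  forall x, A n x @[n --> \oo] --> L x.

Definition spectral_family (E : R -> H -> H) :=
  [/\ forall s, [/\ BH (E s), E s \o E s = E s &
                    forall x y, '[E s x, y] = '[x, E s y]],
      forall s t, s <= t -> ople (E s) (E t),
      forall s x, E t x @[t --> s^'+] --> E s x,
      forall x, E t x @[t --> -oo] --> (0 : H)
    & forall x, E t x @[t --> +oo] --> x].

(* The partition points are a :: s; u lists the tags. *)
Definition tagged_partition (a b delta : R) (s : seq R) (u : nat -> R) :=
  itv_partition a b s /\ forall i, (i < size s)%N ->
    nth b (a :: s) i <= u i <= nth b s i /\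
    nth b s i - nth b (a :: s) i <= delta.

(* The spectral mass of the i-th interval ]p_i, p_(i+1)] of the partition. *)
Definition increment (E : R -> H -> H) (a b : R) (s : seq R) (i : nat) :=
  fun x : H => E (nth b s i) x - E (nth b (a :: s) i) x.

(* S = \int g(s) dE_s over ]a, b], as the operator-norm limit of Riemann-
   Stieltjes sums. When E a = 0 and E b = 1 the measure dE is carried by
   ]a, b] and, g being continuous, this is the integral over the spectrum. *)
Definition is_spectral_integral (E : R -> H -> H) (a b : R) (g : R -> R) S :=
  forall eps : R, 0 < eps -> exists2 delta : R, 0 < delta &
  forall s u, tagged_partition a b delta s u ->
  forall x, `|S x - \sum_(i < size s) (g (u i))%:C *: increment E a b s i x|
            <= eps%:C * `|x|.

(* S = \int\int phi(s, t) dE_s X dE_t, as the operator-norm limit of double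
   Riemann-Stieltjes sums. *)
Definition is_double_operator_integral (E : R -> H -> H) (a b : R)
    (phi : R -> R -> R) X S :=
  forall eps : R, 0 < eps -> exists2 delta : R, 0 < delta &
  forall s u t v, tagged_partition a b delta s u ->
    tagged_partition a b delta t v ->
  forall x, `|S x - \sum_(i < size s) \sum_(j < size t)
      (phi (u i) (v j))%:C *: increment E a b s i (X (increment E a b t j x))|
            <= eps%:C * `|x|.

(* The spectral decomposition of a positive invertible A: the spectrum of A
   lies in ]a, b] with 0 < a. *)
Definition spectral_decomposition A (E : R -> H -> H) (a b : R) :=
  [/\ spectral_family E, 0 < a < b, E a = (fun=> 0), E b = id
    & is_spectral_integral E a b id A].

Definition fun_calc (f : R -> R) A : H -> H :=
  xget (fun=> 0) [set S | exists E a b,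
    spectral_decomposition A E a b /\ is_spectral_integral E a b f S].

Definition is_induced_Aluthge (f : R -> R) T S := exists U E a b,
  [/\ polar_decomposition T U, spectral_decomposition (opabs T) E a b
    & is_double_operator_integral E a b (fun s t => s * f (t / s)) U S].

Definition induced_Aluthge (f : R -> R) T : H -> H :=
  xget (fun=> 0) [set S | is_induced_Aluthge f T S].

End Operators.

(* Only the values of f on ]0, +oo[ matter. Continuity is part of the
   definition so that [fun_calc f] is meaningful. *)
Definition operator_monotone (R : realType) (f : R -> R) :=
  (forall x, 0 < x -> {for x, continuous f}) /\
  forall (K : hilbertSpace R) (A B : K -> K), BHpp A -> BHpp B ->
    ople A B -> ople (fun_calc f A) (fun_calc f B).

(* The representing functions of the operator means
   A m_f B = A^(1/2) f (A^(-1/2) B A^(-1/2)) A^(1/2). *)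
Definition representing_function (R : realType) (f : R -> R) :=
  [/\ forall x, 0 < x -> 0 < f x, operator_monotone f & f 1 = 1].

(* Main.v *)
(** Write T = U P and alpha(A) = U^-1 A U. For a positive invertible Q commuting
    with alpha(Q), and E the spectral family of Q, moving U to the left in the
    double operator integral turns the transform of U Q into U Q', where
    Q' = int int s f(t/s) d(alpha E)_s dE_t is a joint function of alpha(Q) and Q;
    so the iterates are U Q_n for a sequence Q_n of positive operators. The two
    bounds on f give
      Q_(n+1) <= (1 - lam) alpha(Q_n) + lam Q_n   and
      Q_(n+1)^-1 <= (1 - lam) alpha(Q_n^-1) + lam Q_n^-1.
    Since T is semi-hyponormal, P <= alpha(P), and by induction
    Q_n <= Q_(n+1) <= alpha(Q_n) <= alpha^(n+1)(P) <= L. Hence Q_n increases to some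
    M <= L and Q_n^-1 decreases to V = M^-1. In the limit the second inequality
    gives V <= alpha(V), while alpha(V) <= V is clear; so alpha(M) = M, whence
    alpha^n(P) <= alpha^n(M) = M for all n, and L <= M. *)

Require Import Defs.
From HB Require Import structures.
From mathcomp Require Import all_boot all_order all_algebra sesquilinear.
From mathcomp Require Import all_classical all_reals all_analysis.
From mathcomp Require Import complex ring lra.

Set Implicit Arguments.
Unset Strict Implicit.
Unset Printing Implicit Defensive.

Import Order.TTheory GRing.Theory Num.Theory.
Import numFieldNormedType.Exports.

Local Open Scope classical_set_scope.
Local Open Scope complex_scope.
Local Open Scope ring_scope.

(** Commutation and order carry the analysis. Since alpha(Q) commutes with Q, the increments of
    alpha(E) and E multiply to orthogonal projections adding up to 1, so a double Riemann sum is a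
    diagonal operator: scalar inequalities between kernels become operator inequalities, and the
    sums of g(s, t) = s f(t / s) and of 1 / g are exact inverses. This is how the lower bound on f,
    which reads 1 / g <= (1 - lam) / s + lam / t, becomes a statement about Q_(n+1)^-1; inversion
    reverses the order and yields Q_n <= Q_(n+1). That Q_n commutes with alpha(Q_n) is propagated
    together with its commutation with every alpha^k(Q_n); this is where centeredness enters. The
    transform is defined by choice among all polar and spectral decompositions, so its value is
    known only after uniqueness: of positive square roots, of the spectral family, and of the double
    integral when the end points a, b change. The spectral theorem rests on monotone convergence:
    square roots and kernel projections are strong limits of monotone sequences. *)

Section RealDot.
Variables (R : realType) (H : hilbertSpace R).
Implicit Types (x y z : H) (c : R).

(* All estimates take place in the underlying real Hilbert space, with inner
   product Re <x, y>. *)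
Definition rdot x y : R := complex.Re (hdot H x y).
Definition hn x : R := complex.Re `|x|.

Lemma Re_conj (z : R[i]) : complex.Re (Num.conj z) = complex.Re z.
Proof. by case: z. Qed.

Lemma rdotC x y : rdot x y = rdot y x.
Proof. by rewrite /rdot hermC expr0 mul1r Re_conj. Qed.

Lemma rdotDl x y z : rdot (x + y) z = rdot x z + rdot y z.
Proof. by rewrite /rdot linearDl raddfD. Qed.

Lemma rdotDr x y z : rdot z (x + y) = rdot z x + rdot z y.
Proof. by rewrite rdotC rdotDl !(rdotC z). Qed.

Lemma rdotZl c x y : rdot (c%:C *: x) y = c * rdot x y.
Proof. by rewrite /rdot linearZl_LR /=; case: (hdot H x y) => a b /=; rewrite mul0r subr0. Qed.

Lemma rdotZr c x y : rdot x (c%:C *: y) = c * rdot x y.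
Proof. by rewrite rdotC rdotZl rdotC. Qed.

Lemma rdotNl x y : rdot (- x) y = - rdot x y.
Proof. by rewrite -scaleN1r -(rmorphN1 (real_complex R)) rdotZl mulN1r. Qed.

Lemma rdotNr x y : rdot x (- y) = - rdot x y.
Proof. by rewrite rdotC rdotNl rdotC. Qed.

Lemma rdotBl x y z : rdot (x - y) z = rdot x z - rdot y z.
Proof. by rewrite rdotDl rdotNl. Qed.

Lemma rdotBr x y z : rdot z (x - y) = rdot z x - rdot z y.
Proof. by rewrite rdotDr rdotNr. Qed.

Lemma rdot0l x : rdot 0 x = 0.
Proof. by rewrite -(subrr 0) rdotBl subrr. Qed.

Lemma rdot0r x : rdot x 0 = 0.
Proof. by rewrite rdotC rdot0l. Qed.

Lemma rdot_suml (I : Type) (s : seq I) (F : I -> H) y :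
  rdot (\sum_(i <- s) F i) y = \sum_(i <- s) rdot (F i) y.
Proof.
by elim/big_ind2: _ => [|? ? ? ? <- <-|//]; [exact: rdot0l | exact: rdotDl].
Qed.

Lemma rdot_sumr (I : Type) (s : seq I) (F : I -> H) y :
  rdot y (\sum_(i <- s) F i) = \sum_(i <- s) rdot y (F i).
Proof. by rewrite rdotC rdot_suml; apply: eq_bigr => i _; rewrite rdotC. Qed.

Lemma hnC x : `|x| = (hn x)%:C.
Proof. by rewrite /hn RRe_real// ger0_real. Qed.

Lemma hn_ge0 x : 0 <= hn x.
Proof. by rewrite -ler0c -hnC normr_ge0. Qed.

Lemma hn_sqr x : hn x ^+ 2 = rdot x x.
Proof. by rewrite /rdot -hnormE hnC -rmorphXn. Qed.

Lemma rdot_ge0 x : 0 <= rdot x x.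
Proof. by rewrite -hn_sqr sqr_ge0. Qed.

Lemma hn_eq0 x : (hn x == 0) = (x == 0).
Proof. by rewrite -(@normr_eq0 _ _ x) hnC (inj_eq (@complexI _)). Qed.

Lemma rdot_eq0 x : (rdot x x == 0) = (x == 0).
Proof. by rewrite -hn_sqr sqrf_eq0 hn_eq0. Qed.

Lemma rdot_le0 x : rdot x x <= 0 -> x = 0.
Proof. by move=> h; apply/eqP; rewrite -rdot_eq0 eq_le h rdot_ge0. Qed.

Lemma rdot_inj x y : (forall z, rdot x z = rdot y z) -> x = y.
Proof.
move=> h; apply/eqP; rewrite -subr_eq0; apply/eqP/rdot_le0.
by rewrite rdotBl h subrr.
Qed.

Lemma hn0 : hn (0 : H) = 0.
Proof. by apply/eqP; rewrite hn_eq0. Qed.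

Lemma hnD x y : hn (x + y) <= hn x + hn y.
Proof. by rewrite -lecR rmorphD /= -!hnC ler_normD. Qed.

Lemma hnN x : hn (- x) = hn x.
Proof. by rewrite /hn normrN. Qed.

Lemma hnBC x y : hn (x - y) = hn (y - x).
Proof. by rewrite -hnN opprB. Qed.

Lemma hnB x y : hn (x - y) <= hn x + hn y.
Proof. by rewrite -(hnN y) hnD. Qed.

Lemma hnZ c x : hn (c%:C *: x) = `|c| * hn x.
Proof.
by apply: (@complexI R); rewrite -hnC normrZ hnC rmorphM /= normc_def/= expr0n addr0 sqrtr_sqr.
Qed.

Lemma hn_le c x : 0 <= c -> (hn x <= c) = (rdot x x <= c ^+ 2).
Proof. by move=> c0; rewrite -hn_sqr ler_sqr// nnegrE hn_ge0. Qed.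

Lemma quad_discr (a b c : R) :
  (forall t, 0 <= a + 2 * t * b + t ^+ 2 * c) -> 0 <= c -> b ^+ 2 <= a * c.
Proof.
move=> h; rewrite le0r => /predU1P[c0|c0].
  have [->|b0] := eqVneq b 0; first by rewrite c0 mulr0 expr0n.
  (* For c = 0 the polynomial is affine in t; at this t it equals -1. *)
  have := h (- (a + 1) / (2 * b)).
  have -> : a + 2 * (- (a + 1) / (2 * b)) * b + (- (a + 1) / (2 * b)) ^+ 2 * c = -1.
    by rewrite c0; field; rewrite b0.
  by lra.
have := h (- b / c).
have -> : a + 2 * (- b / c) * b + (- b / c) ^+ 2 * c = (a * c - b ^+ 2) / c.
  by field; rewrite gt_eqF.
by rewrite pmulr_lge0 ?invr_gt0// subr_ge0.
Qed.

Lemma cauchy_schwarz x y : rdot x y <= hn x * hn y.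
Proof.
apply: le_trans (ler_norm _) _.
rewrite -ler_sqr ?nnegrE ?mulr_ge0 ?hn_ge0 ?normr_ge0//.
rewrite exprMn !hn_sqr real_normK ?num_real//; apply: quad_discr (rdot_ge0 y) => t.
have := rdot_ge0 (x + t%:C *: y).
by rewrite !(rdotDl, rdotDr, rdotZl, rdotZr) (rdotC y x); lra.
Qed.

(** Since <x, i y> = - i <x, y>, the imaginary part is again a value of [rdot]; through this
    identity results on the real form return to the complex one. *)
Lemma hdotE x y : hdot H x y = (rdot x y +i* rdot x ('i *: y))%C.
Proof.
rewrite /rdot linearZr_LR /=; case: (hdot H x y) => a b /=.
by rewrite mul0r mulN1r sub0r opprK.
Qed.

End RealDot.
Arguments hn {R H}.
Arguments rdot {R H}.

(** * Bounded operators: ring structure, self-adjointness, positive order *)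

Section BoundedOperators.
Variables (R : realType) (H : hilbertSpace R).

Lemma BH_bounded (A : H -> H) : BH A ->
  exists2 M : R, 0 < M & forall x, hn (A x) <= M * hn x.
Proof.
move=> [linA contA].
pose L : {linear H -> H} := HB.pack A (GRing.isLinear.Build _ _ _ _ A linA).
have /linear_bounded_continuous/linear_boundedP : continuous L by [].
move=> /pinfty_ex_gt0 [M M0 bM].
have MR : M = (complex.Re M)%:C by rewrite RRe_real// gtr0_real.
exists (complex.Re M); first by move: M0; rewrite MR ltcR.
by move=> x; have := bM x; rewrite !hnC MR -rmorphM lecR.
Qed.

Lemma bounded_BH (A : H -> H) (M : R) : linear A ->
  (forall x, hn (A x) <= M * hn x) -> BH A.
Proof.
move=> linA bA; split=> //.
pose L : {linear H -> H} := HB.pack A (GRing.isLinear.Build _ _ _ _ A linA).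
suff : continuous L by [].
apply/linear_bounded_continuous/linear_boundedP; near=> r => x.
rewrite (@le_trans _ _ (M%:C * `|x|))//.
  by rewrite !hnC -rmorphM lecR; exact: bA.
rewrite ler_wpM2r//; near: r; apply: nbhs_pinfty_ge.
by rewrite complex_real.
Unshelve. all: by end_near. Qed.

(** Bundling makes the operators a ring and a module, so that algebraic rewriting and big sums
    apply. Scalars are real because real combinations preserve self-adjointness. *)
Record bop := Bop { bfun :> H -> H; bfun_BH : BH bfun }.

HB.instance Definition _ := gen_eqMixin bop.
HB.instance Definition _ := gen_choiceMixin bop.

Local Notation "c %:B" := (c *: (1 : bop)) (at level 2, format "c %:B").
Implicit Types (A B C : bop) (x y : H) (c : R).

Lemma bopP A B : (forall x, A x = B x) -> A = B.
Proof.
case: A B => [A hA] [B hB] /= /funext AB; subst B.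
by congr Bop; exact: Prop_irrelevance.
Qed.

Lemma bfun_linear A : linear A. Proof. by case: (bfun_BH A). Qed.

HB.instance Definition _ A := GRing.isLinear.Build _ _ _ _ (bfun A) (@bfun_linear A).

Lemma BH0 : BH (fun=> 0 : H).
Proof. by apply: (@bounded_BH _ 0) => [a u v|x]; rewrite ?scaler0 ?addr0// hn0 mul0r. Qed.

Lemma BH1 : BH (id : H -> H).
Proof. by apply: (@bounded_BH _ 1) => [//|x]; rewrite mul1r. Qed.

Lemma BHD A B : BH (fun x => A x + B x).
Proof.
have [M _ hM] := BH_bounded (bfun_BH A); have [N _ hN] := BH_bounded (bfun_BH B).
apply: (@bounded_BH _ (M + N)) => [a u v|x].
  by rewrite !linearP scalerDr addrACA.
by rewrite mulrDl (le_trans (hnD _ _))// lerD.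
Qed.

Lemma BHN A : BH (fun x => - A x).
Proof.
have [M _ hM] := BH_bounded (bfun_BH A).
apply: (@bounded_BH _ M) => [a u v|x]; last by rewrite hnN.
by rewrite linearP opprD scalerN.
Qed.

Lemma BHZ c A : BH (fun x => c%:C *: A x).
Proof.
have [M _ hM] := BH_bounded (bfun_BH A).
apply: (@bounded_BH _ (`|c| * M)) => [a u v|x]; last by rewrite hnZ -mulrA ler_wpM2l.
by rewrite linearP scalerDr !scalerA mulrC.
Qed.

Lemma BHM A B : BH (fun x => A (B x)).
Proof.
have [M M0 hM] := BH_bounded (bfun_BH A); have [N _ hN] := BH_bounded (bfun_BH B).
apply: (@bounded_BH _ (M * N)) => [a u v|x]; first by rewrite !linearP.
by rewrite -mulrA (le_trans (hM _))// ler_wpM2l// ltW.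
Qed.

Let add A B := Bop (BHD A B).
Let opp A := Bop (BHN A).
Let mul A B := Bop (BHM A B).

Fact bop_addA : associative add. Proof. by move=> A B C; apply: bopP => x /=; rewrite addrA. Qed.
Fact bop_addC : commutative add. Proof. by move=> A B; apply: bopP => x /=; rewrite addrC. Qed.
Fact bop_add0 : left_id (Bop BH0) add. Proof. by move=> A; apply: bopP => x /=; rewrite add0r. Qed.
Fact bop_addN : left_inverse (Bop BH0) opp add.
Proof. by move=> A; apply: bopP => x /=; rewrite addNr. Qed.
HB.instance Definition _ := GRing.isZmodule.Build bop bop_addA bop_addC bop_add0 bop_addN.

(* Not an [nzRingType]: [H] may be trivial. This rules out [algType], hence the
   hand-made [bopZAl] and [bopZAr]. *)
Fact bop_mulA : associative mul. Proof. by move=> A B C; apply: bopP. Qed.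
Fact bop_mul1r : left_id (Bop BH1) mul. Proof. by move=> A; apply: bopP. Qed.
Fact bop_mulr1 : right_id (Bop BH1) mul. Proof. by move=> A; apply: bopP. Qed.
Fact bop_mulDl : left_distributive mul +%R. Proof. by move=> A B C; apply: bopP. Qed.
Fact bop_mulDr : right_distributive mul +%R.
Proof. by move=> A B C; apply: bopP => x /=; rewrite linearD. Qed.
HB.instance Definition _ := GRing.Zmodule_isPzRing.Build bop
  bop_mulA bop_mul1r bop_mulr1 bop_mulDl bop_mulDr.

Let scale c A := Bop (BHZ c A).
Fact bop_scaleA a b A : scale a (scale b A) = scale (a * b) A.
Proof. by apply: bopP => x /=; rewrite scalerA rmorphM. Qed.
Fact bop_scale1 : left_id 1 scale.
Proof. by move=> A; apply: bopP => x /=; rewrite scale1r. Qed.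
Fact bop_scaleDr : right_distributive scale +%R.
Proof. by move=> c A B; apply: bopP => x /=; rewrite scalerDr. Qed.
Fact bop_scaleDl A : {morph scale^~ A : a b / a + b}.
Proof. by move=> a b; apply: bopP => x /=; rewrite rmorphD scalerDl. Qed.
HB.instance Definition _ := GRing.Zmodule_isLmodule.Build R bop
  bop_scaleA bop_scale1 bop_scaleDr bop_scaleDl.

Lemma bopDE A B x : (A + B) x = A x + B x. Proof. by []. Qed.
Lemma bopNE A x : (- A) x = - A x. Proof. by []. Qed.
Lemma bopBE A B x : (A - B) x = A x - B x. Proof. by []. Qed.
Lemma bopME A B x : (A * B) x = A (B x). Proof. by []. Qed.
Lemma bop0E x : (0 : bop) x = 0. Proof. by []. Qed.
Lemma bop1E x : (1 : bop) x = x. Proof. by []. Qed.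
Lemma bopZE c A x : (c *: A) x = c%:C *: A x. Proof. by []. Qed.
Definition bopE := (bopDE, bopNE, bopBE, bopME, bop0E, bop1E, bopZE).

Lemma bop_sumE (I : Type) (s : seq I) (F : I -> bop) x :
  (\sum_(i <- s) F i) x = \sum_(i <- s) F i x.
Proof. by elim/big_ind2: _ => // y B z C <- <-. Qed.

Lemma bopZAl c A B : c *: (A * B) = (c *: A) * B.
Proof. by apply: bopP. Qed.

Lemma bopZAr c A B : c *: (A * B) = A * (c *: B).
Proof. by apply: bopP => x; rewrite !bopE linearZ. Qed.

Lemma comm_scale A B c : GRing.comm A B -> GRing.comm A (c *: B).
Proof. by rewrite /GRing.comm -bopZAl -bopZAr => ->. Qed.

Lemma bop_bounded A : exists2 M : R, 0 < M & forall x, hn (A x) <= M * hn x.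
Proof. exact: BH_bounded (bfun_BH A). Qed.

Definition sa A := forall x y, rdot (A x) y = rdot x (A y).

Lemma sa0 : sa 0. Proof. by move=> x y; rewrite !bopE rdot0l rdot0r. Qed.
Lemma sa1 : sa 1. Proof. by []. Qed.
Lemma saD A B : sa A -> sa B -> sa (A + B).
Proof. by move=> a b x y; rewrite !bopE rdotDl rdotDr a b. Qed.
Lemma saN A : sa A -> sa (- A).
Proof. by move=> a x y; rewrite !bopE rdotNl rdotNr a. Qed.
Lemma saB A B : sa A -> sa B -> sa (A - B).
Proof. by move=> a b; apply: saD => //; apply: saN. Qed.
Lemma saZ c A : sa A -> sa (c *: A).
Proof. by move=> a x y; rewrite !bopE rdotZl rdotZr a. Qed.
Lemma saM A B : GRing.comm A B -> sa A -> sa B -> sa (A * B).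
Proof. by move=> AB a b x y; rewrite {2}AB !bopE a b. Qed.
Lemma saX A n : sa A -> sa (A ^+ n).
Proof.
by move=> a; elim: n => [|n IH]; [exact: sa1 | rewrite exprS; apply: saM => //; apply: commrX].
Qed.
(** Symmetry is a separate clause because nonnegativity of the real form Re <A x, x> does not imply
    it. *)
Definition psd A := sa A /\ forall x, 0 <= rdot (A x) x.

Lemma psd_sa A : psd A -> sa A. Proof. by case. Qed.
Lemma psd_ge0 A x : psd A -> 0 <= rdot (A x) x. Proof. by case. Qed.
Lemma psd0 : psd 0.
Proof. by split=> [|x]; [exact: sa0 | rewrite !bopE rdot0l]. Qed.
Lemma psd1 : psd 1.
Proof. by split=> // x; exact: rdot_ge0. Qed.
Lemma psdD A B : psd A -> psd B -> psd (A + B).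
Proof.
move=> [a pa] [b pb]; split=> [|x]; first exact: saD.
by rewrite !bopE rdotDl addr_ge0.
Qed.
Lemma psdZ c A : 0 <= c -> psd A -> psd (c *: A).
Proof.
move=> c0 [a pa]; split=> [|x]; first exact: saZ.
by rewrite !bopE rdotZl mulr_ge0.
Qed.
Lemma psd_sum (I : Type) (s : seq I) (F : I -> bop) :
  (forall i, psd (F i)) -> psd (\sum_(i <- s) F i).
Proof. by move=> h; elim/big_ind: _ => // [|A B]; [exact: psd0 | exact: psdD]. Qed.
Lemma psd_conj A B : sa B -> psd A -> psd (B * A * B).
Proof.
move=> b [a pa]; split=> [x y|x]; rewrite !bopE; first by rewrite b a b.
by rewrite b.
Qed.
Lemma psd_sqr A : sa A -> psd (A * A).
Proof. by move=> a; have := psd_conj a psd1; rewrite mulr1. Qed.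
(** With m the integer half of n, A^n is A^m A A^m or A^m 1 A^m according to the parity of n. *)
Lemma psdX A n : psd A -> psd (A ^+ n).
Proof.
move=> pA; have [m e] : exists m, n = (m + odd n + m)%N.
  by exists n./2; rewrite addnAC addnn addnC odd_double_half.
have sM : sa (A ^+ m) by apply/saX/psd_sa.
by rewrite e !exprD; apply: psd_conj => //; case: odd => //=; rewrite ?expr1 ?expr0//; exact: psd1.
Qed.

Lemma psd_le_trans A B C : psd (B - A) -> psd (C - B) -> psd (C - A).
Proof. by move=> h1 h2; rewrite -(subrKA B); exact: psdD. Qed.

Lemma psd_le_rdot A B x : psd (B - A) -> rdot (A x) x <= rdot (B x) x.
Proof. by move=> /(psd_ge0 x); rewrite !bopE rdotBl subr_ge0. Qed.

Lemma psd_cs A x y : psd A -> rdot (A x) y ^+ 2 <= rdot (A x) x * rdot (A y) y.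
Proof.
move=> [a pa]; apply: quad_discr (pa y) => t.
have := pa (x + t%:C *: y).
by rewrite linearD linearZ !(rdotDl, rdotDr, rdotZl, rdotZr) (a y x) (rdotC y); lra.
Qed.

(** Turns a bound on quadratic forms into one on norms: Cauchy-Schwarz for the form of A at x and A
    x, then division by |A x|^2. *)
Lemma psd_normsq A c x : psd A -> psd (c%:B - A) ->
  rdot (A x) (A x) <= c * rdot (A x) x.
Proof.
move=> pA pcA.
have h := psd_cs x (A x) pA.
have {}h : rdot (A x) (A x) ^+ 2 <= rdot (A x) x * (c * rdot (A x) (A x)).
  apply: le_trans h _; rewrite ler_wpM2l ?(psd_ge0 _ pA)//.
  by have := psd_le_rdot (A x) pcA; rewrite !bopE rdotZl.
have [n0|n0] := eqVneq (rdot (A x) (A x)) 0.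
  move: n0 => /eqP; rewrite rdot_eq0 => /eqP ->; by rewrite !rdot0l mulr0.
have {}n0 : 0 < rdot (A x) (A x) by rewrite lt_def n0 rdot_ge0.
by rewrite -(ler_pM2r n0) -expr2 (le_trans h)//; lra.
Qed.

Lemma psd_eq0 A x : psd A -> rdot (A x) x <= 0 -> A x = 0.
Proof.
move=> pA h; have e0 : rdot (A x) x = 0 by apply/eqP; rewrite eq_le h psd_ge0.
apply: rdot_le0; have := psd_cs x (A x) pA; rewrite e0 mul0r.
by rewrite exprn_even_le0//= => /eqP ->.
Qed.

Lemma psd_antisym A B : psd (A - B) -> psd (B - A) -> A = B.
Proof.
move=> h1 h2; apply: bopP => x; apply/eqP; rewrite -subr_eq0 -bopBE; apply/eqP.
by apply: psd_eq0 => //; have := psd_ge0 x h2; rewrite !bopE !rdotBl; lra.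
Qed.

Lemma sa_bound A : sa A -> exists2 c : R, 0 < c & psd (c%:B - A).
Proof.
move=> a; have [M M0 hM] := bop_bounded A; exists M => //; split.
  by apply: saB => //; apply: saZ.
move=> x; rewrite !bopE rdotBl rdotZl subr_ge0.
by rewrite (le_trans (cauchy_schwarz _ _))// -hn_sqr expr2 mulrA ler_wpM2r ?hn_ge0.
Qed.

End BoundedOperators.
Notation "c %:B" := (c *: (1 : bop _)) (at level 2, format "c %:B") : ring_scope.
Notation "A <=o B" := (psd (B - A)) (at level 70) : ring_scope.

(** * Strong convergence and monotone limits *)

Section StrongLimits.
Variables (R : realType) (H : hilbertSpace R).
Implicit Types (A B C : bop H) (x y l : H) (u v : nat -> H) (As Bs : nat -> bop H).

(** The tolerance is real, whereas the normed-space notion takes it in R[i]; [cvto_cvg]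
    translates. *)
Definition cvto u l := forall e : R, 0 < e ->
  exists N, forall n, (N <= n)%N -> hn (u n - l) <= e.

Definition slim As A := forall x, cvto (fun n => As n x) (A x).

Lemma cvto_cvg u l : cvto u l -> u n @[n --> \oo] --> l.
Proof.
move=> h; apply/cvgrPdist_le => e e0.
(* In the partial order of R[i], 0 < e forces e to be real. *)
have eR : e = (complex.Re e)%:C by rewrite RRe_real// gtr0_real.
have [|N hN] := h (complex.Re e); first by move: e0; rewrite eR ltcR.
exists N => // n /= nN.
by rewrite hnC eR lecR hnBC hN.
Qed.

Lemma cvto_unique u l l' : cvto u l -> cvto u l' -> l = l'.
Proof.
move=> h h'; apply/eqP; rewrite -subr_eq0 -hn_eq0 eq_le hn_ge0 andbT.
apply/ler_addgt0Pr => e e0; rewrite add0r.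
have e2 : 0 < e / 2 by lra.
have [N hN] := h _ e2; have [N' hN'] := h' _ e2.
have := hN (maxn N N') (leq_maxl _ _); have := hN' (maxn N N') (leq_maxr _ _).
rewrite (hnBC _ l) => h1 h2.
have -> : l - l' = (l - u (maxn N N')) + (u (maxn N N') - l') by rewrite subrKA.
by apply: le_trans (hnD _ _) _; lra.
Qed.

Lemma cvto_cst l : cvto (fun=> l) l.
Proof. by move=> e e0; exists 0%N => n _; rewrite subrr hn0 ltW. Qed.

Lemma cvtoD u v l l' : cvto u l -> cvto v l' -> cvto (fun n => u n + v n) (l + l').
Proof.
move=> h h' e e0; have e2 : 0 < e / 2 by lra.
have [N hN] := h _ e2; have [N' hN'] := h' _ e2.
exists (maxn N N') => n; rewrite geq_max => /andP[/hN h1 /hN' h2].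
by rewrite opprD addrACA; apply: le_trans (hnD _ _) _; lra.
Qed.

Lemma cvto_lip u l (v : nat -> H) l' (M : R) : 0 < M ->
  (forall n, hn (v n - l') <= M * hn (u n - l)) -> cvto u l -> cvto v l'.
Proof.
move=> M0 hM h e e0; have [|N hN] := h (e / M); first by rewrite divr_gt0.
exists N => n /hN; rewrite ler_pdivlMr// mulrC; exact: le_trans.
Qed.

Lemma cvto_bop A u l : cvto u l -> cvto (fun n => A (u n)) (A l).
Proof.
have [M M0 hM] := bop_bounded A; apply: cvto_lip M0 _ => n.
by rewrite -linearB hM.
Qed.

Lemma cvtoZ (a : R[i]) u l : cvto u l -> cvto (fun n => a *: u n) (a *: l).
Proof.
have aR : `|a| = (complex.Re `|a|)%:C by rewrite RRe_real// ger0_real.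
apply: (@cvto_lip _ _ _ _ (complex.Re `|a| + 1)) => [|n].
  by rewrite ltr_wpDl// -ler0c -aR.
rewrite -scalerBr -lecR -hnC normrZ rmorphM rmorphD/= -aR -hnC ler_wpM2r//.
by rewrite rmorph1 lerDl.
Qed.

Lemma cvto_comp u l (p : nat -> nat) : (forall n, (n <= p n)%N) ->
  cvto u l -> cvto (fun n => u (p n)) l.
Proof.
move=> hp h e /h[N hN]; exists N => n nN; apply: hN; exact: leq_trans (hp n).
Qed.

Lemma cvto_rdot u l y (e : R) : cvto u l -> 0 < e ->
  exists N, forall n, (N <= n)%N -> `|rdot (u n) y - rdot l y| <= e.
Proof.
move=> h e0; have y1 : 0 < hn y + 1 by rewrite ltr_wpDl// hn_ge0.
have [|N hN] := h (e / (hn y + 1)); first by rewrite divr_gt0.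
exists N => n /hN; rewrite ler_pdivlMr// => hn1; rewrite -rdotBl.
have bnd z : hn z * (hn y + 1) <= e -> rdot z y <= e.
  move=> h1; apply: le_trans (cauchy_schwarz _ _) _; apply: le_trans h1.
  by rewrite ler_wpM2l ?hn_ge0// lerDl.
by rewrite ler_norml lerNl -rdotNl !bnd// hnN.
Qed.

Lemma cvto_rdot_ge u l y (c : R) : cvto u l -> (forall n, c <= rdot (u n) y) ->
  c <= rdot l y.
Proof.
move=> h hc; apply/ler_addgt0Pr => e e0.
have [N /(_ N (leqnn _))] := cvto_rdot y h e0.
by rewrite ler_norml => /andP[_]; have := hc N; lra.
Qed.

Lemma slim_cst A : slim (fun=> A) A. Proof. by move=> x; exact: cvto_cst. Qed.

Lemma slim_unique As A B : slim As A -> slim As B -> A = B.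
Proof. by move=> h h'; apply: bopP => x; exact: cvto_unique (h x) (h' x). Qed.

Lemma slimD As Bs A B : slim As A -> slim Bs B -> slim (fun n => As n + Bs n) (A + B).
Proof. by move=> h h' x; exact: cvtoD. Qed.

Lemma slimMl As A C : slim As A -> slim (fun n => C * As n) (C * A).
Proof. by move=> h x; exact: cvto_bop. Qed.

Lemma slimMr As A C : slim As A -> slim (fun n => As n * C) (A * C).
Proof. by move=> h x; exact: h. Qed.

Lemma slimZ As A (c : R) : slim As A -> slim (fun n => c *: As n) (c *: A).
Proof. by move=> h x; apply: cvtoZ. Qed.

Lemma slimN As A : slim As A -> slim (fun n => - As n) (- A).
Proof.
move=> h; rewrite -scaleN1r; have := slimZ (-1) h.
by under eq_fun do rewrite scaleN1r.
Qed.

Lemma slimB As Bs A B : slim As A -> slim Bs B -> slim (fun n => As n - Bs n) (A - B).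
Proof. by move=> h h'; apply: slimD => //; exact: slimN. Qed.

(** A_n B_n x - A B x = A_n (B_n x - B x) + (A_n - A) B x, and the uniform bound on A_n controls the
    first term. *)
Lemma slimM As Bs A B (M : R) : (forall n x, hn (As n x) <= M * hn x) ->
  slim As A -> slim Bs B -> slim (fun n => As n * Bs n) (A * B).
Proof.
move=> hM h h' x e e0; have M1 : 0 < `|M| + 1 by rewrite ltr_wpDl.
have [|N hN] := h' x (e / 2 / (`|M| + 1)); first by rewrite !divr_gt0.
have [|N' hN'] := h (B x) (e / 2); first by rewrite divr_gt0.
exists (maxn N N') => n; rewrite geq_max => /andP[/hN h1 /hN' h2].
rewrite !bopE -(subrKA (As n (B x))) -(linearB (As n)).
apply: le_trans (hnD _ _) _; rewrite (splitr e) lerD// (le_trans (hM _ _))//.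
move: h1; rewrite ler_pdivlMr// mulrC; apply: le_trans; rewrite ler_wpM2r ?hn_ge0//.
by rewrite (le_trans (ler_norm M))// lerDl.
Qed.

Lemma slim_comp As A (p : nat -> nat) : (forall n, (n <= p n)%N) ->
  slim As A -> slim (fun n => As (p n)) A.
Proof. by move=> hp h x; exact: cvto_comp (h x). Qed.

Lemma slim_comm As A C : (forall n, GRing.comm C (As n)) -> slim As A -> GRing.comm C A.
Proof.
move=> hC h; apply: slim_unique (slimMr C h).
by have := slimMl C h; under eq_fun do rewrite hC.
Qed.

Lemma slim_sa As A : (forall n, sa (As n)) -> slim As A -> sa A.
Proof.
move=> hs h x y.
have le' z t : rdot (A z) t <= rdot z (A t).
  apply/ler_addgt0Pr => e e0; have e2 : 0 < e / 2 by lra.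
  have [N hN] := cvto_rdot t (h z) e2; have [N' hN'] := cvto_rdot z (h t) e2.
  have := hN (maxn N N') (leq_maxl _ _); have := hN' (maxn N N') (leq_maxr _ _).
  rewrite (hs _ z t) (rdotC _ z) (rdotC (A t) z) !ler_norml.
  by move=> /andP[? ?] /andP[? ?]; lra.
by apply/eqP; rewrite eq_le le' (rdotC x) (rdotC (A x)) le'.
Qed.

Lemma slim_psd As A : (forall n, psd (As n)) -> slim As A -> psd A.
Proof.
move=> hp h; split=> [|x]; first by apply: slim_sa h => n; exact: psd_sa.
by apply: cvto_rdot_ge (h x) _ => n; exact: psd_ge0.
Qed.

Lemma slim_le As Bs A B : (forall n, As n <=o Bs n) -> slim As A -> slim Bs B -> A <=o B.
Proof. by move=> hp h h'; exact: slim_psd hp (slimB h' h). Qed.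

Lemma hilbert_complete u :
  (forall e : R, 0 < e -> exists N, forall m n, (N <= n <= m)%N -> hn (u m - u n) <= e) ->
  exists l, cvto u l.
Proof.
move=> h.
have cu : cauchy (u n @[n --> \oo]).
  apply/cauchy_exP => e e0.
  have eR : e = (complex.Re e)%:C by rewrite RRe_real// gtr0_real.
  have [|N hN] := h (complex.Re e / 2); first by move: e0; rewrite eR ltcR; lra.
  exists (u N); exists N => // n /= nN.
  rewrite -ball_normE /= hnC eR ltcR hnBC.
  have : 0 < complex.Re e by move: e0; rewrite eR ltcR.
  by have := hN n N; rewrite leqnn nN => /(_ isT); lra.
have /cvg_ex[l hl] : cvg (u n @[n --> \oo]) by exact: cauchy_cvg cu.
exists l => e e0.
move/cvgrPdist_le : hl => /(_ e%:C); rewrite ltcR => /(_ e0)[N _ hN].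
by exists N => n nN; have := hN n nN; rewrite /= hnC lecR hnBC.
Qed.

Lemma psd_bound A (c : R) x : psd A -> A <=o c%:B -> 0 <= c -> hn (A x) <= c * hn x.
Proof.
move=> pA h c0; rewrite hn_le ?mulr_ge0 ?hn_ge0// exprMn hn_sqr.
rewrite (le_trans (psd_normsq x pA h))// expr2 -mulrA ler_wpM2l//.
by have := psd_le_rdot x h; rewrite !bopE rdotZl.
Qed.

Lemma slim_exists As (M : R) : (forall n x, hn (As n x) <= M * hn x) ->
  (forall x, exists l, cvto (fun n => As n x) l) -> exists A, slim As A.
Proof.
move=> hM /choice[A hA].
have linA : linear A.
  move=> a x y; apply: cvto_unique (hA _) _.
  under eq_fun do rewrite linearP.
  by apply: cvtoD; [apply: cvtoZ|]; exact: hA.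
have bA x : hn (A x) <= M * hn x.
  apply/ler_addgt0Pr => e e0; have [N /(_ N (leqnn _)) h] := hA x e e0.
  rewrite -[A x](subKr (As N x)); apply: le_trans (hnB _ _) _.
  by rewrite lerD.
by exists (Bop (bounded_BH linA bA)).
Qed.

Lemma nondecreasing_cauchy (r : nat -> R) (c : R) :
  (forall n, r n <= r n.+1) -> (forall n, r n <= c) ->
  forall e, 0 < e -> exists N, forall m n, (N <= n <= m)%N -> r m - r n <= e.
Proof.
move=> incr bnd e e0.
have mono : {homo r : m n / (m <= n)%N >-> m <= n}.
  by apply: homo_leq => //; [move=> ? ? ?; exact: le_trans].
have hs : has_sup (range r).
  by split; [exists (r 0%N), 0%N | exists c => _ [n _ <-]].
have [_ [N _ <-] hN] := sup_adherent e0 hs.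
exists N => m n /andP[/mono h1 _].
have : r m <= sup (range r) by apply: (ub_le_sup hs.2); exists m.
by lra.
Qed.

(** The numbers <A_n x, x> increase and are bounded, hence Cauchy; as 0 <= A_m - A_n <= c,
    [psd_normsq] gives |(A_m - A_n) x|^2 <= c <(A_m - A_n) x, x>, so A_n x is Cauchy as well. *)
Theorem vigier As (C : bop H) : sa (As 0%N) -> (forall n, As n <=o As n.+1) ->
  (forall n, As n <=o C) -> exists A, slim As A.
Proof.
move=> sa0 incr bnd.
have mono m n : (n <= m)%N -> As n <=o As m.
  elim: m => [|m IH]; first by rewrite leqn0 => /eqP ->; rewrite subrr; exact: psd0.
  rewrite leq_eqVlt => /predU1P[->|]; first by rewrite subrr; exact: psd0.
  by rewrite ltnS => /IH h; exact: psd_le_trans h (incr m).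
have [c c0 hc] := sa_bound (psd_sa (bnd 0%N)).
(* A_m - A_n <= C - A_0, so one constant serves all differences. *)
have diff m n : (n <= m)%N -> As m - As n <=o c%:B.
  move=> nm; apply: psd_le_trans hc.
  rewrite opprB addrACA [X in _ + X]addrC addrACA.
  by apply: psdD => //; exact: mono.
have ptw x (e : R) : 0 < e ->
    exists N, forall m n, (N <= n <= m)%N -> hn (As m x - As n x) <= e.
  move=> e0; have [|||N hN] := @nondecreasing_cauchy
    (fun n => rdot (As n x) x) (rdot (C x) x) _ _ (e ^+ 2 / c).
  - by move=> n; exact: psd_le_rdot.
  - by move=> n; exact: psd_le_rdot.
  - by rewrite divr_gt0// exprn_gt0.
  exists N => m n /[dup] nm /hN /=; rewrite ler_pdivlMr// (mulrC _ c) => h.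
  rewrite hn_le; last exact: ltW.
  apply: le_trans h; case/andP: nm => _ nm.
  by rewrite -rdotBl -bopBE; apply: psd_normsq; [exact: mono | exact: diff].
have [M0 hM0p hM0] := bop_bounded (As 0%N).
apply: (@slim_exists _ (M0 + c)) => [n x|x]; last exact/hilbert_complete/ptw.
rewrite -[As n x](subrK (As 0%N x)) addrC mulrDl; apply: le_trans (hnD _ _) _.
rewrite lerD// -bopBE; apply: psd_bound; [exact: mono | exact: diff | exact: ltW].
Qed.

Lemma vigier_decr As (C : bop H) : sa (As 0%N) -> (forall n, As n.+1 <=o As n) ->
  (forall n, C <=o As n) -> exists A, slim As A.
Proof.
move=> s h b; have [|n|n|A hA] := @vigier (fun n => - As n) (- C).
- exact: saN.
- by rewrite opprK addrC.
- by rewrite opprK addrC.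
exists (- A) => x; have := slimN hA x.
by under eq_fun do rewrite opprK.
Qed.

End StrongLimits.

(** * Square roots and spectral projections as monotone limits *)

Section SquareRoot.
Variables (R : realType) (H : hilbertSpace R).
Implicit Types (A B C D E K S X Y : bop H) (x y : H).

(** Membership in the bicommutant of A; it plays the role of being a function of A. *)
Definition bicomm A B := forall C, GRing.comm C A -> GRing.comm C B.

Lemma bicomm_self A B : bicomm A B -> GRing.comm A B.
Proof. by apply. Qed.

Lemma comm_subr_sqr A B : GRing.comm A B -> (A - B) * (A + B) = A * A - B * B.
Proof. by move=> AB; rewrite mulrBl !mulrDr AB opprD addrA addrK. Qed.

Lemma half_double A : 2^-1 *: (A + A) = A.
Proof. by rewrite scalerDr -scalerDl (_ : 2^-1 + 2^-1 = 1) ?scale1r//; field. Qed.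

(** Polynomials in X with nonnegative coefficients: stable under products, positive when X is, and
    mutually commuting. *)
Inductive cone X : bop H -> Prop :=
| cone0 : cone X 0
| coneX n : cone X (X ^+ n)
| coneD A B : cone X A -> cone X B -> cone X (A + B)
| coneZ c A : 0 <= c -> cone X A -> cone X (c *: A).

Lemma coneM X A B : cone X A -> cone X B -> cone X (A * B).
Proof.
move=> hA hB; elim: hA => [|n|A1 A2 _ h1 _ h2|c A1 c0 _ h1].
- by rewrite mul0r; exact: cone0.
- elim: hB => [|m|B1 B2 _ h1 _ h2|c B1 c0 _ h1].
  + by rewrite mulr0; exact: cone0.
  + by rewrite -exprD; exact: coneX.
  + by rewrite mulrDr; exact: coneD.
  + by rewrite -bopZAr; exact: coneZ.
- by rewrite mulrDl; exact: coneD.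
- by rewrite -bopZAl; exact: coneZ.
Qed.

Lemma cone_psd X A : psd X -> cone X A -> psd A.
Proof.
move=> pX; elim=> [|n|A1 A2 _ h1 _ h2|c A1 c0 _ h1];
  [exact: psd0 | exact: psdX | exact: psdD | exact: psdZ].
Qed.

Lemma cone_bicomm X A : cone X A -> bicomm X A.
Proof.
move=> hA C CX; elim: hA => [|n|A1 A2 _ h1 _ h2|c A1 c0 _ h1].
- exact: commr0.
- exact: commrX.
- exact: commrD.
- exact: comm_scale.
Qed.

Lemma cone_comm X A B : cone X A -> cone X B -> GRing.comm A B.
Proof.
by move=> /cone_bicomm hA /cone_bicomm; apply; apply: commr_sym; exact: hA.
Qed.

Lemma psd_sub1_sqr A : psd A -> A <=o 1 -> A * A <=o 1.
Proof.
move=> pA h; have sA := psd_sa pA; split=> [|x].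
  by apply: saB => //; apply: saM.
rewrite !bopE rdotBl subr_ge0 sA; apply: le_trans (psd_le_rdot x h).
by rewrite -[leRHS]mul1r; apply: psd_normsq => //; rewrite scale1r.
Qed.

Fixpoint sqrt_iter X n : bop H :=
  if n is m.+1 then 2^-1 *: (X + sqrt_iter X m * sqrt_iter X m) else 0.

(* Y is the limit of Y_(n+1) = (X + Y_n^2) / 2; the iterates and their successive
   differences are polynomials in X with nonnegative coefficients, so they
   increase. *)
Lemma sqrt_sub1 X : psd X -> X <=o 1 ->
  exists Y, [/\ Y <=o 1, (1 - Y) * (1 - Y) = 1 - X & bicomm X Y].
Proof.
move=> pX X1; pose Y := sqrt_iter X.
have coneY n : cone X (Y n).
  elim: n => [|n IH] /=; first exact: cone0.
  apply: coneZ => //; apply: coneD; last exact: coneM.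
  by rewrite -[X in cone _ X]expr1; exact: coneX.
have coneS n : cone X (Y n.+1 - Y n).
  elim: n => [|n IH].
    by rewrite /Y /= subr0 mulr0 addr0; apply: coneZ => //;
       rewrite -[X in cone _ X]expr1; exact: coneX.
  have -> : Y n.+2 - Y n.+1 = 2^-1 *: ((Y n.+1 - Y n) * (Y n.+1 + Y n)).
    rewrite comm_subr_sqr; last by apply: (cone_comm (coneY _)) (coneY _).
    have YS m : Y m.+1 = 2^-1 *: (X + Y m * Y m) by [].
    by rewrite (YS n.+1) [in X in _ - X = _](YS n) -scalerBr opprD addrACA subrr add0r.
  by apply: coneZ => //; apply: coneM => //; apply: coneD.
have Y1 n : Y n <=o 1.
  elim: n => [|n IH]; first by rewrite subr0; exact: psd1.
  have -> : 1 - Y n.+1 = 2^-1 *: (1 - X) + 2^-1 *: (1 - Y n * Y n).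
    rewrite -scalerDr addrACA -opprD scalerBr; congr (_ - _).
    by rewrite half_double.
  apply: psdD; apply: psdZ => //.
  by apply: psd_sub1_sqr => //; exact: cone_psd (coneY n).
have [||n|L hL] := @vigier _ _ Y 1.
- exact: sa0.
- by move=> n; exact: cone_psd (coneS n).
- exact: Y1.
exists L; split.
- by apply: slim_le hL (slim_cst 1).
(* The limit solves 2 L = X + L^2, that is (1 - L)^2 = 1 - X. *)
- have hM : L = 2^-1 *: (X + L * L).
    have h1 : slim (fun n => Y n.+1) L by apply: slim_comp hL.
    apply: slim_unique h1 _; apply: slimZ; apply: slimD; first exact: slim_cst.
    apply: (@slimM _ _ _ _ _ _ 1 _ hL hL) => n x.
    apply: psd_bound => //; last by rewrite scale1r; exact: Y1.
    exact: cone_psd (coneY n).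
  have {}hM : X = L + L - L * L.
    apply: (addIr (L * L)); rewrite subrK -[LHS]half_double scalerDr.
    by rewrite -hM.
  by rewrite [in RHS]hM mulrBl mul1r mulrBr mulr1 !opprD !opprK !addrA.
- by move=> C CX; apply: slim_comm hL => n; exact: cone_bicomm (coneY n) C CX.
Qed.

(** Puts 1 - A / c between 0 and 1, the range in which the iterations for roots and kernels
    operate. *)
Lemma psd_scaled A : psd A -> exists c : R, [/\ 0 < c, psd (1 - c^-1 *: A) & 1 - c^-1 *: A <=o 1].
Proof.
move=> pA; have [c c0 hc] := sa_bound (psd_sa pA); exists c; split => //.
  have -> : 1 - c^-1 *: A = c^-1 *: (c%:B - A).
    by rewrite scalerBr scalerA mulVf ?scale1r// gt_eqF.
  by apply: psdZ => //; rewrite invr_ge0 ltW.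
by rewrite opprB addrCA subrr addr0; apply: psdZ => //; rewrite invr_ge0 ltW.
Qed.

Lemma sqrt_exists A : psd A -> exists S, [/\ psd S, S * S = A & bicomm A S].
Proof.
move=> pA; have [c [c0 h1 h2]] := psd_scaled pA.
have [Y [Y1 YY bY]] := sqrt_sub1 h1 h2.
exists (Num.sqrt c *: (1 - Y)); split.
- by apply: psdZ => //; exact: sqrtr_ge0.
- rewrite -bopZAl -bopZAr scalerA -expr2 sqr_sqrtr ?ltW// YY subKr scalerA.
  by rewrite mulfV ?scale1r// gt_eqF.
- move=> C CA; apply: comm_scale; apply: commrB; first exact: commr1.
  by apply: bY; apply: commrB; [exact: commr1 | exact: comm_scale].
Qed.

(** Any positive root T commutes with T^2, hence with the root Q from the bicommutant, so (T + Q) (T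
    - Q) = 0. On y = (T - Q) x the nonnegative numbers <T y, y> and <Q y, y> then add up to 0, so T
    y = Q y = 0 and |y|^2 = <x, (T - Q) y> = 0. *)
Lemma sqrt_unique S S' : psd S -> psd S' -> S * S = S' * S' -> S = S'.
Proof.
move=> pS pS' SS'; have [Q [pQ QQ bQ]] := sqrt_exists (psd_sqr (psd_sa pS)).
suff main T : psd T -> T * T = S * S -> T = Q by rewrite (main S)// (main S').
move=> pT TT; have cTQ : GRing.comm T Q.
  by apply: bQ; rewrite -TT /GRing.comm mulrA.
have sTQ : sa (T - Q) by apply: saB; exact: psd_sa.
have TQ0 : (T + Q) * (T - Q) = 0.
  by rewrite mulrBr !mulrDl cTQ opprD addrA addrK TT QQ subrr.
apply: bopP => x; apply/eqP; rewrite -subr_eq0 -bopBE; apply/eqP; apply: rdot_le0.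
set y := (T - Q) x.
have : rdot (T y) y + rdot (Q y) y = 0.
  by rewrite -rdotDl -bopDE -bopME TQ0 bop0E rdot0l.
have t0 := psd_ge0 y pT; have q0 := psd_ge0 y pQ => h.
have Ty : T y = 0 by apply: psd_eq0 => //; lra.
have Qy : Q y = 0 by apply: psd_eq0 => //; lra.
by rewrite {1}/y sTQ bopBE Ty Qy subrr rdot0r.
Qed.

Lemma sqr_exp_sub A n : A ^+ n * A ^+ n - A ^+ n.+1 * A ^+ n.+1 =
  A ^+ n * (1 - A * A) * A ^+ n.
Proof. by rewrite mulrBr mulr1 mulrBl {1}exprSr exprS !mulrA. Qed.

(* The projection is the decreasing limit of (1 - K / c)^(2 n), where K <= c. *)
Lemma kernel_projection K : psd K -> exists E,
  [/\ sa E, E * E = E, K * E = 0, forall x, K x = 0 -> E x = x & bicomm K E].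
Proof.
move=> pK; have [c [c0 pM M1]] := psd_scaled pK.
set M := 1 - c^-1 *: K in pM M1; have sM := psd_sa pM.
(* The power M^(2 n), split into equal factors so that positivity is immediate. *)
pose G n := M ^+ n * M ^+ n.
have sG n : psd (G n) by apply/psd_sqr/saX.
have Gdecr n : G n.+1 <=o G n.
  rewrite /G sqr_exp_sub.
  by apply: psd_conj; [exact: saX | exact: psd_sub1_sqr].
have G1 n : G n <=o 1.
  elim: n => [|n]; first by rewrite /G expr0 mulr1 subrr; exact: psd0.
  exact: psd_le_trans.
have [||n|E hE] := @vigier_decr _ _ G 0.
- exact: psd_sa.
- exact: Gdecr.
- by rewrite subr0.
have bG n x : hn (G n x) <= 1 * hn x.
  by apply: psd_bound => //; rewrite scale1r.
exists E; split.
- by apply: slim_sa hE => n; exact: psd_sa.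
(* G (2 n) = G n G n, so the limit is idempotent. *)
- have h1 : slim (fun n => G (n + n)%N) E.
    by apply: (slim_comp _ hE) => n; exact: leq_addr.
  apply/esym; apply: slim_unique h1 _; rewrite (_ : (fun n => _) = (fun n => G n * G n)).
    exact: (slimM bG hE hE).
  by apply/funext => n; rewrite /G exprD -!mulrA.
(* M^2 E = E. For y = E x this gives |M y| = |y|, while |M y|^2 <= <M y, y> = |y|^2 - <K y, y> / c;
   hence <K y, y> <= 0. *)
- have h1 : slim (fun n => G n.+1) E by apply: slim_comp hE.
  have MME : M * M * E = E.
    apply/esym; apply: slim_unique h1 _.
    rewrite (_ : (fun n => _) = (fun n => M * M * G n)); first exact: slimMl.
    by apply/funext => n; rewrite /G -(expr2 M) -!exprD addnS addSn.
  apply: bopP => x; rewrite bopME bop0E; apply: psd_eq0 => //.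
  set y := E x.
  have MMy : M (M y) = y by rewrite /y -!bopME MME.
  have h2 : rdot (M y) (M y) <= rdot (M y) y.
    by rewrite -[leRHS]mul1r; apply: psd_normsq => //; rewrite scale1r.
  have : rdot (M y) (M y) = rdot y y by rewrite -sM MMy.
  have : rdot (M y) y = rdot y y - c^-1 * rdot (K y) y by rewrite !bopE rdotBl rdotZl.
  have := psd_ge0 y pK; rewrite -(@pmulr_rle0 _ c^-1) ?invr_gt0//; lra.
- move=> x Kx; have Mx n : (M ^+ n) x = x.
    by elim: n => // n IH; rewrite exprS bopME IH !bopE Kx scaler0 subr0.
  apply: cvto_unique (hE x) _; rewrite /G.
  by under eq_fun do rewrite bopME !Mx; exact: cvto_cst.
- move=> C CK; apply: slim_comm hE => n; have CM : GRing.comm C M.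
    by apply: commrB; [exact: commr1 | exact: comm_scale].
  by apply: commrM; exact: commrX.
Qed.

(* E is the projection onto the kernel of |D| + D, that is 1_(D <= 0). *)
Lemma spectral_projection D : sa D -> exists E,
  [/\ sa E, E * E = E, bicomm D E, forall x, D x = 0 -> E x = x &
      psd (- (D * E)) /\ psd (D * (1 - E))].
Proof.
move=> sD; have [S [pS SS bS]] := sqrt_exists (psd_sqr sD).
have bDS : bicomm D S by move=> C CD; apply: bS; apply: commrM.
have sS := psd_sa pS; have cDS : GRing.comm D S by exact: bicomm_self.
set Z := S + D; have sZ : sa Z by exact: saD.
(* The square of Z = |D| + D has the same kernel as Z, and its positivity follows from
   self-adjointness alone. *)
have [E [sE EE KE fE bE]] := kernel_projection (psd_sqr sZ).
have bDE : bicomm D E.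
  by move=> C CD; apply: bE; apply: commrM; apply: commrD => //; exact: bDS.
have cDE := bicomm_self bDE.
have cSE : GRing.comm S E by apply: bDE; exact: commr_sym.
have ZE : Z * E = 0.
  apply: bopP => x; apply: rdot_le0; rewrite bopME sZ.
  by rewrite -(bopME Z Z) -(bopME (Z * Z)) KE bop0E rdot0r.
have DE : D * E = - (S * E).
  by apply/eqP; rewrite -addr_eq0 -mulrDl addrC ZE.
(* Z (S - D) = S^2 - D^2 = 0, so the range of S - D lies in the kernel of Z and is fixed by E. *)
have SDE : (S - D) * (1 - E) = 0.
  have cSDE : GRing.comm (S - D) E by apply: commr_sym; apply: commrB; exact: commr_sym.
  rewrite mulrBr mulr1 cSDE; apply/eqP; rewrite subr_eq0; apply/eqP; apply: bopP => x.
  rewrite [RHS]bopME fE// -bopME -mulrA.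
  have -> : Z * (S - D) = 0.
    by rewrite mulrDl !mulrBr cDS SS addrA subrK subrr.
  by rewrite mulr0.
have DE' : D * (1 - E) = S * (1 - E).
  by apply/eqP; rewrite eq_sym -subr_eq0 -mulrBl SDE.
have proj F : F * F = F -> sa F -> GRing.comm S F -> psd (S * F).
  by move=> FF sF SF; rewrite -FF mulrA SF; exact: psd_conj.
exists E; split => //.
- move=> x Dx; apply: fE; have Sx : S x = 0.
    by apply: rdot_le0; rewrite sS -bopME SS bopME Dx linear0 rdot0r.
  by rewrite bopME [X in Z X]bopE Sx Dx addr0 linear0.
- split; first by rewrite DE opprK; exact: proj.
  rewrite DE'; apply: proj => //.
  + by rewrite mulrBr mulr1 mulrBl mul1r EE subrr subr0.
  + by apply: saB.
  + by apply: commrB => //; exact: commr1.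
Qed.

End SquareRoot.

(** * Finite orthogonal resolutions of the identity *)

Section Resolutions.
Variables (R : realType) (H : hilbertSpace R).
Implicit Types (A B C : bop H) (x y : H).

(** Members may vanish, as increments over gaps in the spectrum do. *)
Definition resolution (I : finType) (p : I -> bop H) :=
  [/\ forall i, sa (p i), forall i j, p i * p j = if i == j then p i else 0
    & \sum_i p i = 1].

Lemma psd_proj A : sa A -> A * A = A -> psd A.
Proof. by move=> sA AA; rewrite -AA; exact: psd_sqr. Qed.

Section OneResolution.
Variables (I : finType) (p : I -> bop H) (res : resolution p).

Lemma res_idem i : p i * p i = p i.
Proof. by case: res => _ -> _; rewrite eqxx. Qed.

Lemma res_psd i : psd (p i).
Proof. by apply: psd_proj (res_idem i); case: res. Qed.

Lemma res_rdot (v : I -> H) : (forall i, p i (v i) = v i) ->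
  rdot (\sum_i v i) (\sum_i v i) = \sum_i rdot (v i) (v i).
Proof.
move=> pv; rewrite rdot_suml; apply: eq_bigr => i _; rewrite rdot_sumr (bigD1 i)//=.
rewrite big1 ?addr0// => j ji; case: res => sp ortho _.
by rewrite -(pv i) -(pv j) sp -bopME ortho eq_sym (negbTE ji) bop0E rdot0r.
Qed.

Lemma res_split x : \sum_i rdot (p i x) (p i x) = rdot x x.
Proof.
rewrite -res_rdot; first by case: res => _ _ sum1; rewrite -bop_sumE sum1.
by move=> i /=; rewrite -bopME res_idem.
Qed.

(** By Pythagoras, a bound on each block gives the same bound on the sum; this is why Riemann sums
    converge in operator norm. *)
Lemma res_norm (v : I -> H) (M : R) x : 0 <= M -> (forall i, p i (v i) = v i) ->
  (forall i, hn (v i) <= M * hn (p i x)) -> hn (\sum_i v i) <= M * hn x.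
Proof.
move=> M0 pv hv; rewrite hn_le ?mulr_ge0 ?hn_ge0// res_rdot// exprMn hn_sqr.
rewrite -res_split mulr_sumr; apply: ler_sum => i _.
by rewrite -!hn_sqr -exprMn ler_sqr// nnegrE ?mulr_ge0 ?hn_ge0.
Qed.

(** Coefficients of vanishing members are unconstrained: when two partitions are compared, only
    pairs of intervals that meet have to be estimated. *)
Lemma res_scalar_norm (c : I -> R) (M : R) x : 0 <= M ->
  (forall i, p i != 0 -> `|c i| <= M) -> hn ((\sum_i c i *: p i) x) <= M * hn x.
Proof.
move=> M0 hc; rewrite bop_sumE; apply: res_norm => // i.
  by rewrite bopZE linearZ /= -bopME res_idem.
rewrite bopZE hnZ; have [->|pi0] := eqVneq (p i) 0; first by rewrite bop0E hn0 !mulr0.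
by rewrite ler_wpM2r ?hn_ge0// hc.
Qed.

Lemma res_mul (c d : I -> R) :
  (\sum_i c i *: p i) * (\sum_i d i *: p i) = \sum_i (c i * d i) *: p i.
Proof.
rewrite mulr_suml; apply: eq_bigr => i _; rewrite mulr_sumr (bigD1 i)//=.
rewrite big1 ?addr0 => [|j ji]; first by rewrite -bopZAl -bopZAr scalerA res_idem.
case: res => _ ortho _; rewrite -bopZAl -bopZAr ortho eq_sym (negbTE ji).
by rewrite !scaler0.
Qed.

Lemma res_le (c d : I -> R) : (forall i, c i <= d i) ->
  \sum_i c i *: p i <=o \sum_i d i *: p i.
Proof.
move=> cd; rewrite -sumrB; apply: psd_sum => i; rewrite -scalerBl.
by apply: psdZ; [rewrite subr_ge0 | exact: res_psd].
Qed.

End OneResolution.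

Lemma res_prod (I J : finType) (p : I -> bop H) (q : J -> bop H) :
  resolution p -> resolution q -> (forall i j, GRing.comm (p i) (q j)) ->
  resolution (fun k : I * J => p k.1 * q k.2).
Proof.
move=> [sp op up] [sq oq uq] pq; split.
- by move=> k; apply: saM.
- move=> [i j] [k l] /=; rewrite mulrA -(mulrA (p i)) -(pq k j) mulrA op -mulrA oq.
  by rewrite xpair_eqE; case: eqP => //= _; case: eqP => //= _; rewrite ?mulr0 ?mul0r.
- rewrite -(pair_bigA _ (fun i j => p i * q j)) /=.
  by under eq_bigr do rewrite -mulr_sumr uq mulr1.
Qed.

Lemma res_sum_fst (I J : finType) (p : I -> bop H) (q : J -> bop H) (c : I -> R) :
  resolution q -> \sum_i c i *: p i = \sum_k c k.1 *: (p k.1 * q k.2).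
Proof.
move=> [_ _ uq]; rewrite -(pair_bigA _ (fun i j => c i *: (p i * q j))) /=.
by apply: eq_bigr => i _; rewrite -scaler_sumr -mulr_sumr uq mulr1.
Qed.

Lemma res_sum_snd (I J : finType) (p : I -> bop H) (q : J -> bop H) (c : J -> R) :
  resolution p -> \sum_j c j *: q j = \sum_k c k.2 *: (p k.1 * q k.2).
Proof.
move=> [_ _ up]; rewrite -(pair_bigA _ (fun i j => c j *: (p i * q j))) exchange_big /=.
by apply: eq_bigr => j _; rewrite -scaler_sumr -mulr_suml up mul1r.
Qed.

(* Riemann sums over two partitions are compared through the product of the two
   resolutions instead of a common refinement. *)
Lemma res_compare (I J : finType) (p : I -> bop H) (q : J -> bop H)
    (c : I -> R) (d : J -> R) (e : R) x : resolution p -> resolution q ->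
  (forall i j, GRing.comm (p i) (q j)) -> 0 <= e ->
  (forall i j, p i * q j != 0 -> `|c i - d j| <= e) ->
  hn ((\sum_i c i *: p i) x - (\sum_j d j *: q j) x) <= e * hn x.
Proof.
move=> rp rq pq e0 cd; rewrite -bopBE (res_sum_fst p c rq) (res_sum_snd q d rp).
rewrite -sumrB; under eq_bigr do rewrite -scalerBl.
by apply: (res_scalar_norm (res_prod rp rq pq)) => // -[i j] /=; exact: cd.
Qed.

End Resolutions.

(** * Spectral families and their increments over partitions *)

Section SpectralFamilies.
Variables (R : realType) (H : hilbertSpace R).
Implicit Types (A B C P : bop H) (x y : H) (E F : R -> bop H).

(** For projections E s <= E t is equivalent to E s E t = E s; the case s = t is idempotence. *)
Definition projfam E :=
  (forall s, sa (E s)) /\ (forall s t, s <= t -> E s * E t = E s).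

Definition binc E (a b : R) (s : seq R) (i : nat) : bop H :=
  E (nth b s i) - E (nth b (a :: s) i).

Section Projfam.
Variables (E : R -> bop H) (pE : projfam E).

Lemma projfam_sa s : sa (E s). Proof. by case: pE. Qed.

Lemma projfam_minl s t : s <= t -> E s * E t = E s. Proof. by case: pE => _; apply. Qed.

Lemma projfam_minr s t : s <= t -> E t * E s = E s.
Proof.
move=> st; apply: bopP => x; apply: rdot_inj => y.
by rewrite bopME !projfam_sa -bopME projfam_minl.
Qed.

Lemma projfam_idem s : E s * E s = E s. Proof. exact: projfam_minl. Qed.

Lemma projfam_comm s t : GRing.comm (E s) (E t).
Proof.
by rewrite /GRing.comm; case: (leP s t) => [h|/ltW h];
  rewrite (projfam_minl h) (projfam_minr h).
Qed.

Lemma inc_sa s t : sa (E t - E s).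
Proof. by apply: saB; exact: projfam_sa. Qed.

Lemma inc_idem s t : s <= t -> (E t - E s) * (E t - E s) = E t - E s.
Proof.
by move=> st; rewrite mulrBl !mulrBr !projfam_idem projfam_minr// projfam_minl// subrr subr0.
Qed.

Lemma inc_disjoint s t s' t' : s <= t -> s' <= t' -> t <= s' ->
  (E t - E s) * (E t' - E s') = 0.
Proof.
move=> st st' ts; have tt' := le_trans ts st'; have ss := le_trans st ts.
by rewrite mulrBl !mulrBr !projfam_minl ?subrr// (le_trans ss).
Qed.

Lemma inc_comm s t s' t' : GRing.comm (E t - E s) (E t' - E s').
Proof.
by apply: commrB; apply: commr_sym; apply: commrB; exact: projfam_comm.
Qed.

End Projfam.

Lemma partition_mono (a b : R) s i j : itv_partition a b s -> (i <= j <= size s)%N ->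
  nth b (a :: s) i <= nth b (a :: s) j.
Proof.
move=> [ps _] /andP[ij js].
have srt : sorted <=%O (a :: s) by apply: sub_path ps => x y /ltW.
have := sorted_leq_nth le_trans (@lexx _ _) b srt.
by apply => //; rewrite inE /= ltnS// (leq_trans ij).
Qed.

Lemma tagged_range (a b delta : R) s u i : tagged_partition a b delta s u ->
  (i < size s)%N -> a <= u i <= b.
Proof.
move=> [ps ht] si; have [/andP[h1 h2] _] := ht i si; apply/andP; split.
  by apply: le_trans h1; apply: itv_partition_nth_ge ps; rewrite ltnS ltnW.
by apply: le_trans h2 _; exact: (@itv_partition_nth_le _ _ a b s i.+1 si ps).
Qed.

Lemma binc_resolution E (a b : R) s : projfam E -> E a = 0 -> E b = 1 ->
  itv_partition a b s -> resolution (fun i : 'I_(size s) => binc E a b s i).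
Proof.
move=> pE Ea Eb ps.
have mono i j : (i <= j <= size s)%N -> nth b (a :: s) i <= nth b (a :: s) j.
  exact: partition_mono.
have step (i : 'I_(size s)) : nth b (a :: s) i <= nth b s i.
  by apply: (mono i i.+1); rewrite leqnSn ltn_ord.
have disj (i j : 'I_(size s)) : (i < j)%N -> binc E a b s i * binc E a b s j = 0.
  move=> ij; apply: inc_disjoint => //.
  by apply: (mono i.+1 j); rewrite ij ltnW.
split.
- by move=> i; exact: inc_sa.
- move=> i j; case: eqP => [->|/eqP ij]; first exact: inc_idem.
  have : (i < j)%N || (j < i)%N by rewrite -neq_ltn.
  by case/orP => [/disj//|ji]; rewrite /binc inc_comm//; exact: disj.
- rewrite -(big_mkord xpredT (fun i => binc E a b s i)).
  rewrite (@telescope_sumr_eq _ 0 (size s) (fun i => E (nth b (a :: s) i)))//.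
  by rewrite (itv_partition_nth_size _ ps)//= Eb Ea subr0.
Qed.

(** Increments over disjoint intervals annihilate each other, so a nonzero product makes the two
    intervals meet, and each tag is within one mesh of a common point. The partitions may have
    different end points. *)
Lemma binc_overlap E a b s u d a' b' s' u' d' i j : projfam E ->
  tagged_partition a b d s u -> tagged_partition a' b' d' s' u' ->
  (i < size s)%N -> (j < size s')%N ->
  binc E a b s i * binc E a' b' s' j != 0 -> `|u i - u' j| <= d + d'.
Proof.
move=> pE [ps h] [ps' h'] si sj ne0.
have [/andP[h1 h2] h3] := h i si; have [/andP[h1' h2'] h3'] := h' j sj.
have hi : nth b (a :: s) i <= nth b s i by exact: le_trans h2.
have hj : nth b' (a' :: s') j <= nth b' s' j by exact: le_trans h2'.
have l1 : nth b' (a' :: s') j < nth b s i.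
  by rewrite ltNge; apply: contra ne0 => h0; rewrite /binc inc_disjoint.
have l2 : nth b (a :: s) i < nth b' s' j.
  by rewrite ltNge; apply: contra ne0 => h0; rewrite /binc inc_comm// inc_disjoint.
by rewrite ler_norml; apply/andP; split; lra.
Qed.

End SpectralFamilies.

(** * The spectral theorem and uniqueness of the spectral family *)

Section SpectralTheorem.
Variables (R : realType) (H : hilbertSpace R).
Implicit Types (A B C P : bop H) (x y z : H) (E F : R -> bop H).

Lemma partition_mesh (a b d : R) : a < b -> 0 < d -> exists s : seq R,
  itv_partition a b s /\
  forall i, (i < size s)%N -> nth b s i - nth b (a :: s) i <= d.
Proof.
move=> ab d0.
have [N] : exists N : nat, b - a <= N%:R * d.
  exists (Num.bound ((b - a) / d)).
  rewrite -ler_pdivrMr// ltW//; apply: archi_boundP.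
  by rewrite divr_ge0 ?ltW// subr_gt0.
elim: N a ab => [|N IH] a ab; first by rewrite mul0r leNgt subr_gt0 ab.
have [bad _|bad] := leP (b - a) d.
  exists [:: b]; split; first exact: itv_partition1.
  by case.
rewrite -natr1 mulrDl mul1r => hN; have [||s [ps hs]] := IH (a + d); [lra|lra|].
exists (a + d :: s); split.
  case: ps => p l; split => //=; rewrite p andbT; lra.
by case=> [|i] /=; [move=> _; lra | exact: hs].
Qed.

Lemma tagged_partition_exists (a b d : R) : a < b -> 0 < d ->
  exists s u, tagged_partition a b d s u.
Proof.
move=> ab d0; have [s [ps hs]] := partition_mesh ab d0.
exists s, (nth b s); split => // i si; split; last exact: hs.
by rewrite lexx andbT; apply: (partition_mono ps (j := i.+1)); rewrite leqnSn.
Qed.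

Lemma tagged_partition_mono (a b d d' : R) s u : d <= d' ->
  tagged_partition a b d s u -> tagged_partition a b d' s u.
Proof.
move=> dd [ps h]; split=> // i si; have [h1 h2] := h i si; split => //.
exact: le_trans dd.
Qed.

(** Right continuity in algebraic form: the intersection of the ranges of E t over t > s lies in the
    range of E s. *)
Definition right_cont E :=
  forall s x, (forall t, s < t -> E t x = x) -> E s x = x.

Definition stieltjes E a b s (u : nat -> R) : bop H :=
  \sum_(i < size s) u i *: binc E a b s i.

Definition spec_int E a b P := forall e : R, 0 < e ->
  exists2 d, 0 < d & forall s u, tagged_partition a b d s u ->
  forall x, hn (P x - stieltjes E a b s u x) <= e * hn x.

(** The working form of [spectral_decomposition]; the limits of E at both infinities are contained
    in E a = 0 and E b = 1. *)
Definition specdec P E a b :=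
  [/\ projfam E, right_cont E, 0 < a < b, E a = 0 /\ E b = 1 & spec_int E a b P].

Lemma proj_contract A x : sa A -> A * A = A -> hn (A x) <= hn x.
Proof.
move=> sA AA; rewrite hn_le ?hn_ge0// hn_sqr -subr_ge0.
have -> : rdot x x - rdot (A x) (A x) = rdot (x - A x) (x - A x).
  by rewrite !rdotBl !rdotBr !sA -!bopME AA subrr subr0.
exact: rdot_ge0.
Qed.

(** E s is the projection 1_(P <= s) obtained from D = P - s: <P y, y> is at most s |y|^2 on its
    range and at least s |y|^2 on its kernel. For s < t a vector in the range of E s and the kernel
    of E t must vanish, which gives monotonicity; the same comparison with the bounds of P gives E a
    = 0 and E b = 1. *)
Lemma spectral_theorem P (c : R) : psd P -> 0 < c -> c%:B <=o P ->
  exists E a b, specdec P E a b /\ forall s, bicomm P (E s).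
Proof.
move=> pP c0 cP; have sP := psd_sa pP.
have sPs (s : R) : sa (P - s%:B) by apply: saB => //; exact: saZ.
have bPs (s : R) : bicomm P (P - s%:B).
  by move=> C CP; apply: commrB => //; apply: comm_scale; exact: commr1.
have [E hE] := choice (fun s => spectral_projection (sPs s)).
have sE s : sa (E s) by case: (hE s).
have EE s : E s * E s = E s by case: (hE s).
have bE s : bicomm P (E s) by move=> C /(bPs s); case: (hE s) => _ _ + _ _; apply.
have lo s y : E s y = y -> rdot (P y) y <= s * rdot y y.
  move=> Ey; have [_ _ _ _ [/(psd_ge0 y) + _]] := hE s.
  by rewrite bopNE bopME Ey !bopE rdotNl rdotBl rdotZl; lra.
have up s y : E s y = 0 -> s * rdot y y <= rdot (P y) y.
  move=> Ey; have [_ _ _ _ [_ /(psd_ge0 y)]] := hE s.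
  by rewrite bopME [(1 - E s) y]bopBE Ey subr0 !bopE rdotBl rdotZl; lra.
have EC s t : GRing.comm (E s) (E t).
  by apply: (bE t); apply: commr_sym; exact: bicomm_self (bE s).
have pE : projfam E.
  split=> // s t; rewrite le_eqVlt => /predU1P[->//|st].
  apply: bopP => x; apply/eqP; rewrite -subr_eq0 -opprB oppr_eq0; apply/eqP.
  set y := _ - _.
  have Esy : E s y = y.
    by rewrite /y linearB /= -!bopME ?mulrA !EE.
  have Ety : E t y = 0.
    by rewrite /y linearB /= -!bopME ?mulrA (EC t s) -mulrA EE subrr.
  have := le_trans (up t y Ety) (lo s y Esy); rewrite -subr_le0 -mulrBl.
  by rewrite pmulr_rle0 ?subr_gt0//; exact: rdot_le0.
(* The vector y = x - E s x is in the range of every E t with t > s, so <P y, y> <= s |y|^2, and E s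
   y = 0 gives the reverse inequality; hence (P - s) y = 0, and E s fixes the kernel of P - s. *)
have rE : right_cont E.
  move=> s x ht; apply/eqP; rewrite eq_sym -subr_eq0; apply/eqP; set y := x - E s x.
  have Esy : E s y = 0 by rewrite /y linearB /= -bopME EE subrr.
  have Ety t : s < t -> E t y = y.
    by move=> st; rewrite /y linearB /= ht// -bopME EC bopME ht.
  have le0 : rdot ((P - s%:B) y) y <= 0.
    rewrite !bopE rdotBl rdotZl subr_le0.
    have [->|y0] := eqVneq y 0; first by rewrite !rdot0r mulr0.
    have {}y0 : 0 < rdot y y by rewrite lt_def rdot_eq0 y0 rdot_ge0.
    apply/ler_addgt0Pr => e e0; have := lo (s + e / rdot y y) y.
    rewrite mulrDl divfK ?gt_eqF//; apply; apply: Ety.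
    by rewrite ltrDl divr_gt0.
  have [_ _ _ ker [_ pD]] := hE s.
  have := psd_eq0 pD; move=> /(_ y); rewrite bopME [(1 - E s) y]bopBE Esy subr0.
  by move=> /(_ le0) /ker; rewrite Esy.
have [b0 b00 hb0] := sa_bound sP.
(* Strictly below the lower bound c and strictly above the upper bound b0, so that both end
   projections are trivial. *)
set a := c / 2; set b := b0 + a.
have a0 : 0 < a by rewrite divr_gt0.
have ab : 0 < a < b by rewrite a0 /b ltrDr b00.
have Ea : E a = 0.
  apply: bopP => x; apply: rdot_le0; set y := E a x.
  have h1 := lo a y; have h2 := psd_le_rdot y cP.
  move: h1 h2; rewrite /y -bopME EE -/y !bopE rdotZl => /(_ erefl) h1 h2.
  have := le_trans h2 h1; rewrite -subr_le0 -mulrBl pmulr_rle0//.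
  by rewrite subr_gt0 /a ltr_pdivrMr// mulr_natr mulr2n ltrDl.
have Eb : E b = 1.
  apply: bopP => x; apply/eqP; rewrite eq_sym -subr_eq0; apply/eqP; apply: rdot_le0.
  set y := _ - _.
  have Ey : E b y = 0 by rewrite /y linearB /= -bopME EE subrr.
  have h1 := up b y Ey; have := psd_le_rdot y hb0; rewrite !bopE rdotZl => h2.
  have := le_trans h1 h2; rewrite -subr_le0 -mulrBl pmulr_rle0//.
  by rewrite /b addrAC subrr add0r.
exists E, a, b; split=> //; split=> // e e0.
have e2 : 0 < e / 2 by rewrite divr_gt0.
(* On a block with left end p, half of e pays for P - p and half for the distance from p to the
   tag. *)
exists (e / 2) => // s u [ps hs] x.
have res := binc_resolution pE Ea Eb ps; have [sD _ sum1] := res.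
have bD i : GRing.comm P (binc E a b s i).
  by apply: commrB; exact: bicomm_self (bE _).
rewrite -{1}[P x](bopME P 1) -sum1 mulr_sumr -bopBE /stieltjes -sumrB bop_sumE.
apply: (res_norm res) => [|i|i]; first exact: ltW.
  by rewrite -bopME mulrBr mulrA -bD -mulrA (res_idem res) -bopZAr (res_idem res).
set D := binc E a b s i; set p := nth b (a :: s) i; set q := nth b s i.
have [/andP[h1 h2] h3] := hs i (ltn_ord i).
have pq : p <= q by exact: le_trans h2.
have DD : D * D = D by exact: (res_idem res).
have EpD : E p * D = 0.
  by rewrite /D /binc mulrBr EE (projfam_minl pE pq) subrr.
have EqD : E q * D = D.
  by rewrite /D /binc mulrBr EE (projfam_minr pE pq).
set Z := (P - p%:B) * D.
have cD : GRing.comm (P - p%:B) D.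
  by apply: commr_sym; apply: commrB; [exact/commr_sym/bD | apply: comm_scale; exact: commr1].
have ZE z : rdot (Z z) z = rdot (P (D z)) (D z) - p * rdot (D z) (D z).
  have -> : Z = D * ((P - p%:B) * D) by rewrite mulrA -cD -mulrA DD.
  by rewrite bopME (sD i) !bopE rdotBl rdotZl.
have pZ : psd Z.
  split=> [|z]; first by apply: saM => //; exact: sD.
  by rewrite ZE subr_ge0; apply: up; rewrite -bopME EpD.
have Ze : Z <=o (e / 2)%:B.
  split=> [|z]; first by apply: saB; [exact: saZ | exact: psd_sa].
  rewrite bopBE rdotBl ZE bopZE bop1E rdotZl.
  have hl := lo q (D z); rewrite -bopME EqD in hl; have {}hl := hl erefl.
  have hc : rdot (D z) (D z) <= rdot z z.
    by rewrite -!hn_sqr ler_sqr ?nnegrE ?hn_ge0//; apply: proj_contract; [exact: sD|].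
  have r0 := rdot_ge0 (D z).
  have : (q - p) * rdot (D z) (D z) <= (e / 2) * rdot (D z) (D z) by rewrite ler_wpM2r.
  have : (e / 2) * rdot (D z) (D z) <= (e / 2) * rdot z z by rewrite ler_wpM2l// ltW.
  by lra.
have := psd_bound (D x) pZ Ze (ltW e2); rewrite -bopME /Z -mulrA DD -/Z => hZ.
have -> : (P * D - u i *: D) x = Z x - (u i - p)%:C *: D x.
  by rewrite /Z !bopE rmorphB scalerBl opprB addrA subrK.
apply: le_trans (hnB _ _) _; rewrite hnZ ger0_norm; last by rewrite subr_ge0.
rewrite (splitr e) [leRHS]mulrDl lerD// ler_wpM2r ?hn_ge0//.
by apply: le_trans h3; rewrite lerB.
Qed.

Lemma spec_int_slim P E a b : a < b -> spec_int E a b P ->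
  exists As : nat -> bop H, slim As P /\ forall n, exists s u, As n = stieltjes E a b s u.
Proof.
move=> ab h.
have ex n : exists A : bop H, (exists s u, A = stieltjes E a b s u) /\
    forall x, hn (P x - A x) <= n.+1%:R^-1 * hn x.
  have [|d d0 hd] := h n.+1%:R^-1; first by rewrite invr_gt0.
  have [s [u hsu]] := tagged_partition_exists ab d0.
  by exists (stieltjes E a b s u); split; [exists s, u | exact: hd].
have [As hA] := choice ex; exists As; split; last by move=> n; case: (hA n).
move=> x e e0; exists (Num.bound (hn x / e)) => n hn.
rewrite hnBC; apply: le_trans ((hA n).2 x) _.
rewrite mulrC ler_pdivrMr// mulrC -ler_pdivrMr//.
apply: le_trans (ltW (archi_boundP _)) _; first by rewrite divr_ge0 ?hn_ge0// ltW.
by rewrite ler_nat ltnW.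
Qed.

Lemma stieltjes_comm E C a b s u : (forall t, GRing.comm C (E t)) ->
  GRing.comm C (stieltjes E a b s u).
Proof.
by move=> h; apply: commr_sum => i _; apply: comm_scale; apply: commrB.
Qed.

Section Specdec.
Variables (P : bop H) (E : R -> bop H) (a b : R) (dec : specdec P E a b).

Lemma specdec_comm s : GRing.comm (E s) P.
Proof.
case: dec => pE _ /andP[_ ab] _ /(spec_int_slim ab)[As [hA hs]].
apply: slim_comm hA => n; have [t [u ->]] := hs n.
by apply: stieltjes_comm => t'; exact: projfam_comm.
Qed.

(** Intervals lying beyond s do not see x, and the other tags are at most s + mesh. In the bound s +
    e + e one e is the mesh, the other the error of the Riemann sum. *)
Lemma specdec_norm_le s x : 0 < s -> E s x = x -> hn (P x) <= s * hn x.
Proof.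
case: dec => pE _ /andP[a0 ab] [Ea Eb] hP s0 Ex.
suff h e : 0 < e -> hn (P x) <= (s + e + e) * hn x.
  have [x0|x0] := eqVneq (hn x) 0.
    by have := h 1 ltr01; rewrite x0 !mulr0.
  have {}x0 : 0 < hn x by rewrite lt_def x0 hn_ge0.
  rewrite -ler_pdivrMr//; apply/ler_addgt0Pr => e e0; rewrite ler_pdivrMr//.
  by have := h (e / 2); rewrite -addrA -splitr; apply; rewrite divr_gt0.
move=> e0; have [d d0 hd] := hP e e0.
have m0 : 0 < Num.min d e by rewrite lt_min d0.
have [t [u htu]] := tagged_partition_exists ab m0.
have [pt ht] := htu; have res := binc_resolution pE Ea Eb pt.
rewrite -(subrK (stieltjes E a b t u x) (P x)); apply: le_trans (hnD _ _) _.
rewrite addrC mulrDl lerD//; last first.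
  by apply: hd; apply: tagged_partition_mono htu; rewrite ge_min lexx.
rewrite /stieltjes bop_sumE; apply: (res_norm res); first by rewrite ltW// addr_gt0.
  by move=> i; rewrite -bopME -bopZAr (res_idem res).
move=> i; rewrite bopZE hnZ.
have [sp|sp] := leP s (nth b (a :: t) i).
  suff -> : binc E a b t i x = 0 by rewrite hn0 !mulr0.
  have [/andP[h1 h2] _] := ht i (ltn_ord i).
  rewrite -Ex -bopME mulrBl !(projfam_minr pE) ?subrr//.
  by apply: le_trans sp _; apply: le_trans h2.
rewrite ler_wpM2r ?hn_ge0//.
have /andP[ua _] := tagged_range htu (ltn_ord i); rewrite ger0_norm ?(le_trans (ltW a0))//.
have [/andP[h1 h2] h3] := ht i (ltn_ord i).
have : Num.min d e <= e by rewrite ge_min lexx orbT.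
lra.
Qed.

(** Dually, only intervals ending beyond s see x, so a Riemann sum S has <S x, x> >= (s - e) |x|^2;
    Cauchy-Schwarz turns this into a lower bound on |S x|. *)
Lemma specdec_norm_ge s x : 0 < s -> E s x = 0 -> s * hn x <= hn (P x).
Proof.
case: dec => pE _ /andP[a0 ab] [Ea Eb] hP s0 Ex.
have [x0|x0] := eqVneq (hn x) 0; first by rewrite x0 mulr0 hn_ge0.
have {}x0 : 0 < hn x by rewrite lt_def x0 hn_ge0.
suff h e : 0 < e -> s * hn x <= hn (P x) + (e + e) * hn x.
  rewrite -ler_pdivlMr//; apply/ler_addgt0Pr => e e0.
  rewrite -lerBlDr ler_pdivlMr// mulrBl lerBlDr.
  by have := h (e / 2); rewrite -splitr; apply; rewrite divr_gt0.
move=> e0; have [d d0 hd] := hP e e0.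
have m0 : 0 < Num.min d e by rewrite lt_min d0.
have [t [u htu]] := tagged_partition_exists ab m0.
have [pt ht] := htu; have res := binc_resolution pE Ea Eb pt.
set S := stieltjes E a b t u.
have h1 : hn (S x) <= hn (P x) + e * hn x.
  rewrite -(subrK (P x) (S x)) addrC; apply: le_trans (hnD _ _) _; rewrite lerD// hnBC.
  by apply: hd; apply: tagged_partition_mono htu; rewrite ge_min lexx.
suff h2 : (s - e) * rdot x x <= rdot (S x) x.
  have := le_trans h2 (cauchy_schwarz _ _).
  by rewrite -hn_sqr expr2 mulrA ler_pM2r//; lra.
rewrite /S /stieltjes bop_sumE rdot_suml -(res_split res) mulr_sumr.
apply: ler_sum => i _; have [sD _ _] := res.
have e1 : rdot (binc E a b t i x) x = rdot (binc E a b t i x) (binc E a b t i x).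
  by rewrite [RHS]sD -bopME (res_idem res) sD.
rewrite bopZE rdotZl e1.
have [sp|sp] := leP (nth b t i) s.
  suff -> : binc E a b t i x = 0 by rewrite rdot0r !mulr0.
  have [/andP[h3 h4] _] := ht i (ltn_ord i).
  have : binc E a b t i * E s = binc E a b t i.
    by rewrite mulrBl !(projfam_minl pE)//; apply: le_trans sp; apply: le_trans h4.
  by move=> <-; rewrite bopME Ex linear0.
rewrite ler_wpM2r ?rdot_ge0//.
have [/andP[h3 h4] h5] := ht i (ltn_ord i).
have : Num.min d e <= e by rewrite ge_min lexx orbT.
lra.
Qed.

End Specdec.

Lemma geometric_gap (s t c d : R) : 0 < s < t ->
  (forall n, t ^+ n * c <= s ^+ n * d) -> c <= 0.
Proof.
move=> /andP[s0 st] h; have t0 : 0 < t by exact: lt_trans st.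
have hc n : c <= (s / t) ^+ n * d.
  by rewrite expr_div_n mulrAC ler_pdivlMr ?exprn_gt0// mulrC.
have cv : (fun n => (s / t) ^+ n * d) @ \oo --> 0 * d.
  apply: cvgMl; apply: cvg_expr.
  by rewrite ger0_norm ?divr_ge0 ?ltW// ltr_pdivrMr// mul1r.
rewrite -(mul0r d) -(cvg_lim _ cv)//; apply: limr_ge; first by apply/cvg_ex; eexists; exact: cv.
exact: nearW.
Qed.

(* A vector x with ||P^n x|| <= s^n ||x|| for all n has no component in a subspace
   reducing P on which P >= t > s. The families E and F need not commute. *)
Lemma specdec_le P E F a b a' b' s : specdec P E a b -> specdec P F a' b' ->
  0 < s -> F s * E s = E s.
Proof.
move=> dE dF s0; apply: bopP => x; rewrite bopME; have [pE _ _ _ _] := dE.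
(* Right continuity of F leaves room between s and t: with y = z - F t z, t^n |y| <= |P^n y| <= |P^n
   z| <= s^n |z| for all n. *)
have [pF rF _ _ _] := dF; apply: rF => t st; set z := E s x.
have t0 : 0 < t by exact: lt_trans st.
apply/eqP; rewrite eq_sym -subr_eq0 -hn_eq0 eq_le hn_ge0 andbT; set y := z - _.
apply: (@geometric_gap s t _ (hn z)); first by rewrite s0.
move=> n; have Ez : E s z = z by rewrite /z -bopME (projfam_idem pE).
have Fy : F t y = 0 by rewrite /y linearB /= -bopME (projfam_idem pF) subrr.
have cE : GRing.comm (E s) P by exact: specdec_comm dE s.
have cF : GRing.comm (F t) P by exact: specdec_comm dF t.
have hz k : hn ((P ^+ k) z) <= s ^+ k * hn z.
  elim: k => [|k IH]; first by rewrite !expr0 mul1r.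
  rewrite !exprS bopME -mulrA; apply: le_trans (specdec_norm_le dE s0 _) _.
    by rewrite -bopME (commrX k cE) bopME Ez.
  by rewrite ler_wpM2l// ltW.
have hy k : t ^+ k * hn y <= hn ((P ^+ k) y).
  elim: k => [|k IH]; first by rewrite !expr0 mul1r.
  rewrite !exprS bopME -mulrA; apply: le_trans _ (specdec_norm_ge dF t0 _).
    by rewrite ler_wpM2l// ltW.
  by rewrite -bopME (commrX k cF) bopME Fy linear0.
apply: le_trans (hy n) _; apply: le_trans _ (hz n).
have -> : (P ^+ n) y = (1 - F t) ((P ^+ n) z).
  rewrite [RHS]bopBE bop1E -(bopME (F t)) (commrX n cF) bopME.
  by rewrite /y [LHS]linearB.
apply: proj_contract; first by apply: saB => //; exact: projfam_sa.
by rewrite mulrBl mul1r mulrBr mulr1 (projfam_idem pF) subrr subr0.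
Qed.

(** F s E s = E s and E s F s = F s, whose adjoints agree only if E s = F s; for s <= 0 both vanish.
    This removes the choice of spectral family from [induced_Aluthge], though not the choice of end
    points. *)
Lemma specdec_unique P E F a b a' b' : specdec P E a b -> specdec P F a' b' -> E = F.
Proof.
move=> dE dF; apply/funext => s; have [pE _ /andP[a0 _] [Ea _] _] := dE.
have [pF _ /andP[a0' _] [Fa _] _] := dF.
have [s0|s0] := leP s 0.
  have -> : E s = 0 by rewrite -(projfam_minl pE (le_trans s0 (ltW a0))) Ea mulr0.
  by rewrite -(projfam_minl pF (le_trans s0 (ltW a0'))) Fa mulr0.
rewrite -(specdec_le dF dE s0); apply: bopP => x; apply: rdot_inj => y.
by rewrite bopME !(projfam_sa pE) (projfam_sa pF) -bopME (specdec_le dE dF s0).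
Qed.

End SpectralTheorem.

(** * Double Riemann-Stieltjes integrals for two commuting families *)

Section DoubleIntegral.
Variables (R : realType) (H : hilbertSpace R).
Implicit Types (A B C P : bop H) (E F G : R -> bop H) (phi psi : R -> R -> R).

Definition square_modulus phi (m M d e : R) := forall x x' y y' : R,
  m <= x <= M -> m <= x' <= M -> m <= y <= M -> m <= y' <= M ->
  `|x - x'| <= d -> `|y - y'| <= d -> `|phi x y - phi x' y'| <= e.

Definition square_uc phi (m M : R) := forall e, 0 < e ->
  exists2 d, 0 < d & square_modulus phi m M d e.

(** The double sum after the operator between the increments has been moved to the left; F stands
    for the conjugated family. *)
Definition dsum phi F E a b s (u : nat -> R) t (v : nat -> R) : bop H :=
  \sum_(i < size s) \sum_(j < size t)
    phi (u i) (v j) *: (binc F a b s i * binc E a b t j).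

Lemma dsum_pair phi F E a b s u t v : dsum phi F E a b s u t v =
  \sum_(k : 'I_(size s) * 'I_(size t))
    phi (u k.1) (v k.2) *: (binc F a b s k.1 * binc E a b t k.2).
Proof.
exact: (pair_bigA _ (fun i j : 'I__ => phi (u i) (v j) *: (binc F a b s i * binc E a b t j))).
Qed.

Lemma dsum_comm phi F E C a b s u t v : (forall r, GRing.comm C (F r)) ->
  (forall r, GRing.comm C (E r)) -> GRing.comm C (dsum phi F E a b s u t v).
Proof.
move=> hF hE; apply: commr_sum => i _; apply: commr_sum => j _; apply: comm_scale.
by apply: commrM; apply: commrB.
Qed.

Section TwoFamilies.
Variables (F E : R -> bop H).
Hypotheses (pF : projfam F) (pE : projfam E).
Hypothesis FE : forall s t, GRing.comm (F s) (E t).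

Lemma binc_comm2 a b s i a' b' t j : GRing.comm (binc F a b s i) (binc E a' b' t j).
Proof. by apply: commrB; apply: commr_sym; apply: commrB; apply: commr_sym; exact: FE. Qed.

Lemma dsum_resolution a b s t : F a = 0 -> F b = 1 -> E a = 0 -> E b = 1 ->
  itv_partition a b s -> itv_partition a b t ->
  resolution (fun k : 'I_(size s) * 'I_(size t) => binc F a b s k.1 * binc E a b t k.2).
Proof.
move=> Fa Fb Ea Eb ps pt.
have rF := binc_resolution pF Fa Fb ps; have rE := binc_resolution pE Ea Eb pt.
by apply: (res_prod rF rE) => i j; exact: binc_comm2.
Qed.

(** Both pairs of end points lie in one interval [m, M], so the same estimate gives the Cauchy
    property and independence of the end points. *)
Lemma dsum_compare phi m M a b s u t v d a' b' s' u' t' v' d' e x :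
  F a = 0 -> F b = 1 -> E a = 0 -> E b = 1 ->
  F a' = 0 -> F b' = 1 -> E a' = 0 -> E b' = 1 ->
  m <= a -> b <= M -> m <= a' -> b' <= M ->
  tagged_partition a b d s u -> tagged_partition a b d t v ->
  tagged_partition a' b' d' s' u' -> tagged_partition a' b' d' t' v' ->
  0 <= e -> square_modulus phi m M (d + d') e ->
  hn (dsum phi F E a b s u t v x - dsum phi F E a' b' s' u' t' v' x) <= e * hn x.
Proof.
move=> Fa Fb Ea Eb Fa' Fb' Ea' Eb' ma bM ma' bM' hs ht hs' ht' e0 mod_phi.
rewrite !dsum_pair.
have r1 := dsum_resolution Fa Fb Ea Eb hs.1 ht.1.
have r2 := dsum_resolution Fa' Fb' Ea' Eb' hs'.1 ht'.1.
have range a0 b0 d0 s0 u0 i : m <= a0 -> b0 <= M -> tagged_partition a0 b0 d0 s0 u0 ->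
    (i < size s0)%N -> m <= u0 i <= M.
  move=> ma0 bM0 h0 i0; have /andP[h1 h2] := tagged_range h0 i0.
  by rewrite (le_trans ma0)// (le_trans h2).
apply: (@res_compare _ _ _ _ _ _ _ _ _ _ r1 r2) => // -[i j] [k l] /=.
  by apply: commrM; apply: commr_sym; apply: commrM;
    rewrite /binc; do ?[exact: inc_comm | exact: binc_comm2 | apply/commr_sym; exact: binc_comm2].
(* Regrouped as a product of two F-increments times a product of two E-increments: both factors are
   nonzero, so both pairs of tags are close. *)
rewrite mulrA -(mulrA (binc F a b s i)) -binc_comm2 mulrA -(mulrA (_ * _)) => ne0.
apply: mod_phi;
  do ?[exact: (range _ _ _ _ _ _ _ _ hs) | exact: (range _ _ _ _ _ _ _ _ hs')
      | exact: (range _ _ _ _ _ _ _ _ ht) | exact: (range _ _ _ _ _ _ _ _ ht')].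
- apply: (binc_overlap pF hs hs') => //.
  by apply: contraNneq ne0 => ->; rewrite mul0r.
- apply: (binc_overlap pE ht ht') => //.
  by apply: contraNneq ne0 => ->; rewrite mulr0.
Qed.

Variables (a b : R).
Hypotheses (Fa : F a = 0) (Fb : F b = 1) (Ea : E a = 0) (Eb : E b = 1).

Definition dint phi A := forall e : R, 0 < e -> exists2 d, 0 < d &
  forall s u t v, tagged_partition a b d s u -> tagged_partition a b d t v ->
  forall x, hn (A x - dsum phi F E a b s u t v x) <= e * hn x.

Variables (s : nat -> seq R) (u : nat -> nat -> R).
Hypothesis hsu : forall n, tagged_partition a b n.+1%:R^-1 (s n) (u n).

(** One fixed sequence of partitions, used on both axes. At each n, order, linear combinations and
    reciprocals of kernels carry over exactly to the sums, and then pass to the strong limit. *)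
Let DS phi n := dsum phi F E a b (s n) (u n) (s n) (u n).

Lemma mesh_small (d : R) : 0 < d -> exists N, forall n, (N <= n)%N ->
  tagged_partition a b d (s n) (u n).
Proof.
move=> d0; exists (Num.bound d^-1) => n hN; apply: tagged_partition_mono (hsu n).
rewrite -[leRHS]invrK lef_pV2 ?posrE ?invr_gt0//.
rewrite (le_trans (ltW (archi_boundP _))) ?invr_ge0 ?ltW//.
by rewrite ltr_nat.
Qed.

Lemma dint_slim phi A : dint phi A -> slim (DS phi) A.
Proof.
move=> h x e e0; have [|d d0 hd] := h (e / (hn x + 1)).
  by rewrite divr_gt0// ltr_wpDl// hn_ge0.
have [N hN] := mesh_small d0; exists N => n nN.
rewrite hnBC; apply: le_trans (hd _ _ _ _ (hN _ nN) (hN _ nN) x) _.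
rewrite mulrAC ler_pdivrMr; last by rewrite ltr_wpDl// hn_ge0.
by rewrite ler_wpM2l// ?ltW// ltrDl.
Qed.

Lemma dsum_bound phi (K : R) n x : 0 <= K ->
  (forall x y, a <= x <= b -> a <= y <= b -> `|phi x y| <= K) ->
  hn (DS phi n x) <= K * hn x.
Proof.
move=> K0 bnd; rewrite /DS dsum_pair.
apply: (res_scalar_norm (dsum_resolution Fa Fb Ea Eb (hsu n).1 (hsu n).1)) => // k _.
by apply: bnd; exact: (tagged_range (hsu n)).
Qed.

(** The limit is taken along the fixed sequence; comparing an arbitrary fine partition with a late
    member of that sequence gives the norm estimate. *)
Lemma dint_exists phi (K : R) : square_uc phi a b ->
  (forall x y, a <= x <= b -> a <= y <= b -> `|phi x y| <= K) ->
  exists A, dint phi A.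
Proof.
move=> uc bnd.
have cmp d s1 u1 t1 v1 n e x : tagged_partition a b (d / 2) s1 u1 ->
    tagged_partition a b (d / 2) t1 v1 -> tagged_partition a b (d / 2) (s n) (u n) ->
    0 < e -> square_modulus phi a b d e ->
    hn (dsum phi F E a b s1 u1 t1 v1 x - DS phi n x) <= e * hn x.
  move=> h1 h2 h3 e0 hm; apply: (dsum_compare _ _ _ _ _ _ _ _ _ _ _ _ _ h1 h2 h3 h3) => //.
    exact: ltW.
  by rewrite -splitr.
have K0 : 0 <= K.
  by apply: le_trans (bnd b b _ _) => //; rewrite lexx andbT (itv_partition_le (hsu 0).1).
have [||A hA] := @slim_exists _ _ (DS phi) K.
- by move=> n x; exact: dsum_bound.
- move=> x; apply: hilbert_complete => e e0.
  have [|d d0 hd] := uc (e / (hn x + 1)).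
    by rewrite divr_gt0// ltr_wpDl// hn_ge0.
  have d2 : 0 < d / 2 by rewrite divr_gt0.
  have [N hN] := mesh_small d2; exists N => m n /andP[Nn nm].
  have Nm := leq_trans Nn nm.
  apply: le_trans (cmp _ _ _ _ _ _ _ x (hN _ Nm) (hN _ Nm) (hN _ Nn) _ hd) _.
    by rewrite divr_gt0// ltr_wpDl// hn_ge0.
  rewrite mulrAC ler_pdivrMr; last by rewrite ltr_wpDl// hn_ge0.
  by rewrite ler_wpM2l// ?ltW// ltrDl.
exists A => e e0; have [d d0 hd] := uc e e0.
have d2 : 0 < d / 2 by rewrite divr_gt0.
exists (d / 2) => // s1 u1 t1 v1 h1 h2 x.
apply/ler_addgt0Pr => e' e'0; have [N hN] := mesh_small d2.
have [N' hN'] := hA x e' e'0; set n := maxn N N'.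
rewrite -(subrKA (DS phi n x)) addrC; apply: le_trans (hnD _ _) _.
rewrite lerD//; last by rewrite hnBC; apply: hN'; exact: leq_maxr.
by rewrite hnBC; apply: cmp hd => //; apply: hN; exact: leq_maxl.
Qed.

Lemma dsum_le phi psi n : (forall x y, a <= x <= b -> a <= y <= b -> phi x y <= psi x y) ->
  DS phi n <=o DS psi n.
Proof.
move=> h; rewrite /DS !dsum_pair.
apply: (res_le (dsum_resolution Fa Fb Ea Eb (hsu n).1 (hsu n).1)) => k.
by apply: h; exact: (tagged_range (hsu n)).
Qed.

Lemma dsum_mulV phi psi n :
  (forall x y, a <= x <= b -> a <= y <= b -> phi x y * psi x y = 1) ->
  DS phi n * DS psi n = 1.
Proof.
move=> h; have res := dsum_resolution Fa Fb Ea Eb (hsu n).1 (hsu n).1.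
rewrite /DS !dsum_pair (res_mul res); case: (res) => _ _ <-.
by apply: eq_bigr => k _; rewrite h ?scale1r//; exact: (tagged_range (hsu n)).
Qed.

Lemma dsum_lin phi psi (c d : R) n :
  DS (fun x y => c * phi x y + d * psi x y) n = c *: DS phi n + d *: DS psi n.
Proof.
rewrite /DS !dsum_pair !scaler_sumr -big_split /=; apply: eq_bigr => k _.
by rewrite scalerDl !scalerA.
Qed.

Lemma dsum_fst (h : R -> R) n :
  DS (fun x _ => h x) n = stieltjes F a b (s n) (h \o u n).
Proof.
rewrite /DS dsum_pair /stieltjes.
by rewrite (res_sum_fst (fun i : 'I_(size (s n)) => binc F a b (s n) i)
  (fun i : 'I_(size (s n)) => h (u n i)) (binc_resolution pE Ea Eb (hsu n).1)).
Qed.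

Lemma dsum_snd (h : R -> R) n :
  DS (fun _ y => h y) n = stieltjes E a b (s n) (h \o u n).
Proof.
rewrite /DS dsum_pair /stieltjes.
by rewrite (res_sum_snd (fun i : 'I_(size (s n)) => binc E a b (s n) i)
  (fun i : 'I_(size (s n)) => h (u n i)) (binc_resolution pF Fa Fb (hsu n).1)).
Qed.

Lemma spec_int_slim_parts (G : R -> bop H) (P : bop H) : spec_int G a b P ->
  slim (fun n => stieltjes G a b (s n) (u n)) P.
Proof.
move=> h x e e0; have [|d d0 hd] := h (e / (hn x + 1)).
  by rewrite divr_gt0// ltr_wpDl// hn_ge0.
have [N hN] := mesh_small d0; exists N => n nN.
rewrite hnBC; apply: le_trans (hd _ _ (hN _ nN) x) _.
rewrite mulrAC ler_pdivrMr; last by rewrite ltr_wpDl// hn_ge0.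
by rewrite ler_wpM2l// ?ltW// ltrDl.
Qed.

Lemma dsum_psd phi n : (forall x y, a <= x <= b -> a <= y <= b -> 0 <= phi x y) ->
  psd (DS phi n).
Proof.
move=> h; rewrite /DS dsum_pair; apply: psd_sum => k; apply: psdZ.
  by apply: h; exact: (tagged_range (hsu n)).
exact: (res_psd (dsum_resolution Fa Fb Ea Eb (hsu n).1 (hsu n).1)).
Qed.

End TwoFamilies.

Lemma tagged_partition_seq (a b : R) : a < b -> exists s u,
  forall n, tagged_partition a b n.+1%:R^-1 (s n) (u n).
Proof.
move=> ab; have ex n : exists su : seq R * (nat -> R),
    tagged_partition a b n.+1%:R^-1 su.1 su.2.
  have [|s [u h]] := @tagged_partition_exists _ a b n.+1%:R^-1 ab.
    by rewrite invr_gt0.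
  by exists (s, u).
have [su h] := choice ex.
by exists (fun n => (su n).1), (fun n => (su n).2).
Qed.

(** B - B_n = B_n (A_n - A) B, so uniformly bounded inverses converge strongly together with A_n. *)
Lemma slim_inv (As Bs : nat -> bop H) A B (K : R) :
  (forall n, Bs n * As n = 1) -> (forall n x, hn (Bs n x) <= K * hn x) ->
  A * B = 1 -> slim As A -> slim Bs B.
Proof.
move=> BA bB AB hA x.
apply: (cvto_lip (M := `|K| + 1) _ _ (hA (B x))); first by rewrite ltr_wpDl.
move=> n; rewrite hnBC.
have -> : B x - Bs n x = Bs n (As n (B x) - A (B x)).
  by rewrite linearB /= -!bopME BA -mulrA AB mulr1.
apply: le_trans (bB _ _) _; rewrite ler_wpM2r ?hn_ge0//.
by rewrite (le_trans (ler_norm K))// lerDl.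
Qed.

End DoubleIntegral.

(** * Uniform continuity of the kernels *)

Section UniformContinuity.
Variable R : realType.

(** Compactness of the segment. Only x is confined to it: y may leave it, since continuity at x is
    that of the whole line. *)
Lemma heine (f : R -> R) (m M e : R) : 0 < e ->
  (forall x, m <= x <= M -> {for x, continuous f}) ->
  exists2 d, 0 < d & forall x y, m <= x <= M -> `|x - y| <= d -> `|f x - f y| <= e.
Proof.
move=> e0 cf.
have /compact_near_coveringP /(_ _ ((0 : R)^'+)
    (fun d x => forall y, `|x - y| <= d -> `|f x - f y| <= e)) := @segment_compact R m M.
move=> /(_ _); case.
  move=> x /= xI; have /cf /cvgrPdist_lt/(_ (e / 2)) : m <= x <= M by move: xI; rewrite in_itv.
  rewrite divr_gt0// => /(_ isT) /nbhs_ballP[r /= r0 hr].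
  have r2 : 0 < r / 2 by rewrite divr_gt0.
  exists (ball x (r / 2), [set d : R | 0 < d < r / 2]) => /=.
    split; first exact: nbhsx_ballx.
    by apply: filterS (filterI (nbhs_right_gt (0 : R)) (nbhs_right_lt r2)) => d [/= -> ->].
  move=> [x' d] /= [bx'] /andP[d0 dr] y xy.
  have h1 : `|f x - f x'| < e / 2.
    by apply: hr; apply: le_ball bx'; rewrite ler_pdivrMr// ler_pMr// ler1n.
  have h2 : `|f x - f y| < e / 2.
    apply: hr; rewrite /ball /= -(subrKA x') (le_lt_trans (ler_normD _ _))//.
    by move: bx'; rewrite /ball /= => bx'; lra.
  rewrite -(subrKA (f x)) (le_trans (ler_normD _ _))// distrC; lra.
move=> d /= d0 hd; exists (d / 2); first by rewrite divr_gt0.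
move=> x y xI; apply: hd => //=.
- by rewrite sub0r normrN ger0_norm ?ltr_pdivrMr ?mulr_natr ?mulr2n ?ltrDl// divr_ge0// ltW.
- by rewrite divr_gt0.
Qed.

(** The quotients t / s stay in [m / M, M / m], where f is uniformly continuous and bounded, and the
    difference splits as (s - s') f(t / s) + s' (f(t / s) - f(t' / s')). *)
Lemma square_uc_perspective (f : R -> R) (m M K : R) : 0 < m < M ->
  (forall x, 0 < x -> {for x, continuous f}) ->
  (forall x, m / M <= x <= M / m -> `|f x| <= K) ->
  square_uc (fun s t => s * f (t / s)) m M.
Proof.
move=> /andP[m0 mM] cf bf e e0; have M0 : 0 < M by exact: lt_trans mM.
have quot s t : m <= s <= M -> m <= t <= M -> m / M <= t / s <= M / m.
  move=> /andP[ms sM] /andP[mt tM]; have s0 : 0 < s by exact: lt_le_trans ms.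
  apply/andP; split.
    by rewrite ler_pM ?invr_ge0 ?(ltW m0) ?(ltW M0)// lef_pV2.
  by rewrite ler_pM ?invr_ge0 ?(ltW s0) ?(le_trans (ltW m0))// lef_pV2.
have e2M : 0 < e / (2 * M) by rewrite divr_gt0// mulr_gt0.
have [|d d0 hd] := @heine f (m / M) (M / m) _ e2M.
  by move=> x /andP[hx _]; apply: cf; apply: lt_le_trans hx; rewrite divr_gt0.
pose K' := `|K| + 1; have K'0 : 0 < K' by rewrite ltr_wpDl.
(* The first bound gives |t / s - t' / s'| <= d, the second makes the summand with s - s' at most e
   / 2. *)
exists (Num.min (d * m ^+ 2 / (2 * M)) (e / (2 * K'))).
  by rewrite lt_min !divr_gt0 ?mulr_gt0 ?exprn_gt0.
move=> s s' t t' hs hs' ht ht'; rewrite !le_min => /andP[ss1 ss2] /andP[tt1 _].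
have [/andP[ms sM] /andP[ms' s'M]] := (hs, hs').
have [/andP[mt tM] /andP[mt' t'M]] := (ht, ht').
have s0 : 0 < s by exact: lt_le_trans ms.
have s'0 : 0 < s' by exact: lt_le_trans ms'.
have t'0 : 0 < t' by exact: lt_le_trans mt'.
have -> : s * f (t / s) - s' * f (t' / s') =
  (s - s') * f (t / s) + s' * (f (t / s) - f (t' / s')) by ring.
rewrite (le_trans (ler_normD _ _))// !normrM (ger0_norm (ltW s'0)) (splitr e) lerD//.
  have fK : `|f (t / s)| <= K'.
    by rewrite (le_trans (bf _ (quot _ _ hs ht)))// /K' (le_trans (ler_norm _))// lerDl.
  apply: le_trans (ler_pM _ _ ss2 fK) _ => //.
  by rewrite le_eqVlt; apply/orP; left; apply/eqP; field; rewrite gt_eqF.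
have fd : `|f (t / s) - f (t' / s')| <= e / (2 * M).
  apply: hd; first exact: quot.
  have -> : t / s - t' / s' = ((t - t') * s' + t' * (s' - s)) / (s * s').
    by field; rewrite !gt_eqF.
  rewrite normrM normfV (gtr0_norm (mulr_gt0 s0 s'0)) ler_pdivrMr ?mulr_gt0//.
  have h1 : `|(t - t') * s' + t' * (s' - s)| <=
      d * m ^+ 2 / (2 * M) * M + M * (d * m ^+ 2 / (2 * M)).
    rewrite (le_trans (ler_normD _ _))// !normrM (gtr0_norm s'0) (gtr0_norm t'0).
    by rewrite lerD// ler_pM ?(ltW t'0) ?(ltW s'0)// distrC.
  apply: le_trans h1 _.
  have -> : d * m ^+ 2 / (2 * M) * M + M * (d * m ^+ 2 / (2 * M)) = d * m ^+ 2.
    by field; rewrite gt_eqF.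
  by rewrite ler_wpM2l ?(ltW d0)// expr2 ler_pM ?(ltW m0).
apply: le_trans (ler_pM _ _ s'M fd) _; rewrite ?(ltW s'0)//.
by rewrite le_eqVlt; apply/orP; left; apply/eqP; field; rewrite gt_eqF.
Qed.

Lemma square_ucV (phi : R -> R -> R) (m M c : R) : 0 < c ->
  (forall x y, m <= x <= M -> m <= y <= M -> c <= phi x y) ->
  square_uc phi m M -> square_uc (fun x y => (phi x y)^-1) m M.
Proof.
move=> c0 hc uc e e0; have [|d d0 hd] := uc (e * c ^+ 2); first by rewrite mulr_gt0 ?exprn_gt0.
exists d => // x x' y y' hx hx' hy hy' xx yy.
have p1 := hc _ _ hx hy; have p2 := hc _ _ hx' hy'.
have p10 := lt_le_trans c0 p1; have p20 := lt_le_trans c0 p2.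
have -> : (phi x y)^-1 - (phi x' y')^-1 = - (phi x y - phi x' y') / (phi x y * phi x' y').
  by field; rewrite !gt_eqF.
rewrite normrM normrN normfV (gtr0_norm (mulr_gt0 p10 p20)) ler_pdivrMr ?mulr_gt0//.
apply: le_trans (hd _ _ _ _ hx hx' hy hy' xx yy) _.
by rewrite ler_wpM2l ?(ltW e0)// expr2 ler_pM ?(ltW c0).
Qed.

End UniformContinuity.

(** * Inverses of positive operators *)

Section Inverses.
Variables (R : realType) (H : hilbertSpace R).
Implicit Types (A B : bop H).

Lemma psd_inv A A' : psd A -> A * A' = 1 -> psd A'.
Proof.
move=> pA AA'; have sA := psd_sa pA.
have e x : x = A (A' x) by rewrite -bopME AA'.
split=> [x y|x]; first by rewrite {2}(e x) sA -e.
by rewrite {2}(e x) rdotC; exact: psd_ge0.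
Qed.

Lemma sa_inv_comm A A' : sa A -> sa A' -> A * A' = 1 -> A' * A = 1.
Proof.
move=> sA sA' AA'; apply: bopP => x; apply: rdot_inj => y.
by rewrite bopME sA' sA -bopME AA'.
Qed.

(** Cauchy-Schwarz for the form of A at A' x and B' x: <B' x, x>^2 <= <A' x, x> <A B' x, B' x> <=
    <A' x, x> <B' x, x>. *)
Lemma psd_inv_le A A' B B' : psd A -> psd B -> A * A' = 1 -> B * B' = 1 ->
  A <=o B -> B' <=o A'.
Proof.
move=> pA pB AA' BB' AB; have pA' := psd_inv pA AA'; have pB' := psd_inv pB BB'.
split=> [|x]; first by apply: saB; exact: psd_sa.
rewrite bopBE rdotBl subr_ge0.
have := psd_cs (A' x) (B' x) pA; rewrite -bopME AA' bop1E => h1.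
have h2 := psd_le_rdot (B' x) AB; rewrite -(bopME B) BB' bop1E in h2.
have p0 := psd_ge0 x pB'; have q0 := psd_ge0 x pA'.
rewrite (rdotC x (A' x)) (rdotC x (B' x)) in h1; rewrite (rdotC x) in h2.
have h3 : rdot (B' x) x ^+ 2 <= rdot (A' x) x * rdot (B' x) x.
  by apply: le_trans h1 _; rewrite ler_wpM2l.
have [->//|n0] := eqVneq (rdot (B' x) x) 0.
by rewrite -(@ler_pM2r _ (rdot (B' x) x)) -?expr2// lt_def n0.
Qed.

Lemma psd_inv_lower A A' : psd A -> A * A' = 1 -> exists2 c : R, 0 < c & c%:B <=o A.
Proof.
move=> pA AA'; have pA' := psd_inv pA AA'.
have [K K0 hK] := sa_bound (psd_sa pA').
exists K^-1; first by rewrite invr_gt0.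
have h : A' <=o K%:B by [].
apply: (psd_inv_le pA' (psdZ (ltW K0) (@psd1 _ H)) _ _ h).
  by apply: sa_inv_comm AA'; exact: psd_sa.
by rewrite -bopZAl mul1r scalerA mulfV ?scale1r// gt_eqF.
Qed.

End Inverses.

(** * Conjugation by a unitary *)

Section Conjugation.
Variables (R : realType) (H : hilbertSpace R).
Variables (U U' : bop H).
Hypotheses (UU' : U * U' = 1) (U'U : U' * U = 1).
Hypothesis Uadj : forall x y, rdot (U x) y = rdot x (U' y).
Implicit Types (A B C Q W : bop H).

Definition conj A := U' * A * U.
Definition unconj A := U * A * U'.

Lemma conj1 : conj 1 = 1. Proof. by rewrite /conj mulr1. Qed.
Lemma conj0 : conj 0 = 0. Proof. by rewrite /conj mulr0 mul0r. Qed.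
Lemma conjM A B : conj (A * B) = conj A * conj B.
Proof. by rewrite /conj !mulrA -(mulrA _ U U') UU' mulr1. Qed.
Lemma conjB A B : conj (A - B) = conj A - conj B.
Proof. by rewrite /conj mulrBr mulrBl. Qed.
Lemma conjZ (c : R) A : conj (c *: A) = c *: conj A.
Proof. by rewrite /conj -bopZAr -bopZAl. Qed.
Lemma unconjM A B : unconj (A * B) = unconj A * unconj B.
Proof. by rewrite /unconj !mulrA -(mulrA _ U' U) U'U mulr1. Qed.
Lemma conjK A : unconj (conj A) = A.
Proof. by rewrite /conj /unconj !mulrA UU' mul1r -mulrA UU' mulr1. Qed.
Lemma unconjK A : conj (unconj A) = A.
Proof. by rewrite /conj /unconj !mulrA U'U mul1r -mulrA U'U mulr1. Qed.

Lemma conj_comm A B : GRing.comm A B -> GRing.comm (conj A) (conj B).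
Proof. by rewrite /GRing.comm -!conjM => ->. Qed.

(** With [comm_unconj], moves a conjugation across a commutator, so that bicommutant arguments for Q
    also apply to alpha(Q). *)
Lemma unconj_comm A B : GRing.comm A (conj B) -> GRing.comm (unconj A) B.
Proof. by rewrite /GRing.comm => h; rewrite -(conjK B) -!unconjM h. Qed.

Lemma comm_unconj A B : GRing.comm (unconj A) B -> GRing.comm A (conj B).
Proof. by move=> /conj_comm; rewrite unconjK. Qed.

Lemma conj_sa A : sa A -> sa (conj A).
Proof.
by move=> sA x y; rewrite /conj !bopME rdotC -Uadj rdotC sA Uadj.
Qed.

Lemma conj_psd A : psd A -> psd (conj A).
Proof.
move=> [sA pA]; split=> [|x]; first exact: conj_sa.
by rewrite /conj !bopME rdotC -Uadj rdotC.
Qed.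

Lemma conj_le A B : A <=o B -> conj A <=o conj B.
Proof. by rewrite -conjB; exact: conj_psd. Qed.

Lemma hn_unitary x : hn (U x) = hn x.
Proof.
apply/eqP; rewrite -(@eqrXn2 _ 2) ?hn_ge0// !hn_sqr Uadj -bopME U'U.
by rewrite bop1E.
Qed.

Lemma hn_unitary_inv x : hn (U' x) = hn x.
Proof. by rewrite -hn_unitary -bopME UU'. Qed.

Lemma slim_conj (As : nat -> bop H) A : slim As A -> slim (fun n => conj (As n)) (conj A).
Proof. by move=> h; apply: slimMr; exact: slimMl. Qed.

Lemma conj_projfam E : projfam E -> projfam (conj \o E).
Proof.
move=> [sE mE]; split=> [s|s t st] /=; first exact: conj_sa.
by rewrite -conjM mE.
Qed.

Lemma conj_stieltjes E a b s u : conj (stieltjes E a b s u) = stieltjes (conj \o E) a b s u.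
Proof.
rewrite /stieltjes /conj mulr_sumr mulr_suml; apply: eq_bigr => i _.
by rewrite -bopZAr -bopZAl /binc /= -!conjB.
Qed.

Lemma conj_spec_int E a b Q : spec_int E a b Q -> spec_int (conj \o E) a b (conj Q).
Proof.
move=> h e e0; have [d d0 hd] := h e e0; exists d => // s u hsu x.
rewrite -conj_stieltjes -bopBE -conjB /conj !bopME hn_unitary_inv.
by rewrite -(hn_unitary x); exact: hd.
Qed.

End Conjugation.

(** * One step of the transform on the positive factor *)

Section AluthgeStep.
Variables (R : realType) (H : hilbertSpace R).
Variables (U U' : bop H).
Hypotheses (UU' : U * U' = 1) (U'U : U' * U = 1).
Hypothesis Uadj : forall x y, rdot (U x) y = rdot x (U' y).
Variables (f : R -> R) (lam : R).
Hypothesis f_cont : forall x, 0 < x -> {for x, continuous f}.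
Hypothesis lam01 : 0 < lam < 1.
Hypothesis f_bound : forall t, 0 < t ->
  (1 - lam + lam * t^-1)^-1 <= f t <= 1 - lam + lam * t.
Implicit Types (A B C Q W : bop H).

(** The perspective of f, which is the mean of the scalars s and t. *)
Let g (s t : R) := s * f (t / s).
Let alpha := conj U U'.

Definition aluthge_dint Q Q' := exists E a b,
  [/\ specdec Q E a b, forall s t, GRing.comm (alpha (E s)) (E t)
    & dint (alpha \o E) E a b g Q'].

Lemma perspective_le s t : 0 < s -> 0 < t -> g s t <= (1 - lam) * s + lam * t.
Proof.
move=> s0 t0; have /andP[_ h] := f_bound (divr_gt0 t0 s0).
have -> : (1 - lam) * s + lam * t = s * (1 - lam + lam * (t / s)).
  by field; rewrite gt_eqF.
by rewrite /g ler_wpM2l// ltW.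
Qed.

Lemma perspective_gt0 s t : 0 < s -> 0 < t -> 0 < g s t.
Proof.
move=> s0 t0; have ts := divr_gt0 t0 s0; have /andP[h _] := f_bound ts.
have /andP[l0 l1] := lam01.
rewrite /g mulr_gt0//; apply: lt_le_trans h; rewrite invr_gt0.
by rewrite addr_gt0 ?subr_gt0// mulr_gt0// invr_gt0.
Qed.

(** The lower bound on f puts g(s, t) above the weighted harmonic mean of s and t, whose reciprocal
    is linear in 1 / s and 1 / t. *)
Lemma perspectiveV_le s t : 0 < s -> 0 < t ->
  (g s t)^-1 <= (1 - lam) * s^-1 + lam * t^-1.
Proof.
move=> s0 t0; have ts := divr_gt0 t0 s0; have /andP[h _] := f_bound ts.
have /andP[l0 l1] := lam01.
have p0 : 0 < 1 - lam + lam * (t / s)^-1.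
  by rewrite addr_gt0 ?subr_gt0// mulr_gt0// invr_gt0.
have -> : (1 - lam) * s^-1 + lam * t^-1 = s^-1 * (1 - lam + lam * (t / s)^-1).
  by field; rewrite !gt_eqF.
rewrite /g invfM ler_wpM2l ?invr_ge0 ?(ltW s0)//.
rewrite -[leRHS]invrK lef_pV2// posrE ?invr_gt0//.
by apply: lt_le_trans h; rewrite invr_gt0.
Qed.

Lemma perspective_uc m M : 0 < m < M -> square_uc g m M.
Proof.
move=> /andP[m0 mM]; have /andP[l0 l1] := lam01.
apply: (@square_uc_perspective _ f m M (1 - lam + lam * (M / m))) => //.
  by rewrite m0.
move=> x /andP[h1 h2]; have x0 : 0 < x.
  by apply: lt_le_trans h1; rewrite divr_gt0// (lt_trans m0).
have /andP[h3 h4] := f_bound x0; rewrite ger0_norm.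
  by apply: le_trans h4 _; rewrite lerD2l ler_wpM2l// ltW.
apply: le_trans h3; rewrite invr_ge0 addr_ge0 ?subr_ge0 ?(ltW l1)//.
by rewrite mulr_ge0 ?(ltW l0)// invr_ge0 ltW.
Qed.

(** Q' and W' are the double integrals of g and 1 / g; their sums are inverse to each other for
    every n, and the two operator inequalities are the scalar ones summed over the joint resolution.
    The commutation clause lets the hypothesis on Q be renewed for Q'. *)
Lemma aluthge_step Q W : psd Q -> Q * W = 1 -> GRing.comm Q (alpha Q) ->
  exists Q' W', [/\ psd Q' /\ Q' * W' = 1,
    forall C, GRing.comm C Q -> GRing.comm C (alpha Q) -> GRing.comm C Q',
    Q' <=o (1 - lam) *: alpha Q + lam *: Q,
    W' <=o (1 - lam) *: alpha W + lam *: W & aluthge_dint Q Q'].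
Proof.
move=> pQ QW QaQ.
have [c c0 cQ] := psd_inv_lower pQ QW.
have [E [a [b [dec bE]]]] := spectral_theorem pQ c0 cQ.
have [pE _ /andP[a0 ab] [Ea Eb] hQ] := dec.
set F := alpha \o E.
have pF : projfam F by exact: conj_projfam.
have Fa : F a = 0 by rewrite /F /= Ea /alpha conj0.
have Fb : F b = 1 by rewrite /F /= Eb /alpha conj1.
have hF : spec_int F a b (alpha Q) by exact: conj_spec_int.
(* The bicommutant is used twice: E t commutes with alpha(Q) because alpha(Q) commutes with Q; then
   U (E t) U^-1 commutes with Q, hence with E s. *)
have FE s t : GRing.comm (F s) (E t).
  have EaQ : GRing.comm (alpha Q) (E t) by exact/bE/commr_sym.
  apply: commr_sym; apply: comm_unconj => //; apply: (bE).
  by apply: unconj_comm => //; exact: commr_sym.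
have [s [u hsu]] := tagged_partition_seq ab.
have pos x : a <= x <= b -> 0 < x by case/andP => h _; exact: lt_le_trans h.
have b0 : 0 < b by exact: lt_trans ab.
have /andP[l0 l1] := lam01; have l1' : 0 < 1 - lam by rewrite subr_gt0.
have g_le x y : a <= x <= b -> a <= y <= b -> g x y <= b.
  move=> hx hy; apply: le_trans (perspective_le (pos _ hx) (pos _ hy)) _.
  have /andP[_ hx'] := hx; have /andP[_ hy'] := hy.
  have -> : b = (1 - lam) * b + lam * b by ring.
  by rewrite lerD// ler_wpM2l// ltW.
have gV_le x y : a <= x <= b -> a <= y <= b -> (g x y)^-1 <= a^-1.
  move=> hx hy; apply: le_trans (perspectiveV_le (pos _ hx) (pos _ hy)) _.
  have /andP[hx' _] := hx; have /andP[hy' _] := hy.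
  have -> : a^-1 = (1 - lam) * a^-1 + lam * a^-1 by ring.
  by rewrite lerD// ler_wpM2l ?(ltW l0) ?(ltW l1')// lef_pV2// posrE pos.
have g_gt0 x y : a <= x <= b -> a <= y <= b -> 0 < g x y.
  by move=> hx hy; apply: perspective_gt0; exact: pos.
have g_ge x y : a <= x <= b -> a <= y <= b -> a <= g x y.
  by move=> hx hy; have := gV_le x y hx hy; rewrite lef_pV2// posrE g_gt0.
have uc : square_uc g a b by apply: perspective_uc; rewrite a0.
have g_norm x y : a <= x <= b -> a <= y <= b -> `|g x y| <= b.
  by move=> hx hy; rewrite gtr0_norm ?g_gt0// g_le.
have gV_norm x y : a <= x <= b -> a <= y <= b -> `|(g x y)^-1| <= a^-1.
  by move=> hx hy; rewrite gtr0_norm ?invr_gt0 ?g_gt0// gV_le.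
have [Q' hQ'] := dint_exists pF pE FE Fa Fb Ea Eb hsu uc g_norm.
have [W' hW'] := dint_exists pF pE FE Fa Fb Ea Eb hsu (square_ucV a0 g_ge uc) gV_norm.
have sQ' := dint_slim hsu hQ'; have sW' := dint_slim hsu hW'.
have sfst : slim (fun n => dsum (fun x _ => x) F E a b (s n) (u n) (s n) (u n)) (alpha Q).
  by under eq_fun do rewrite (dsum_fst F pE Ea Eb hsu id); exact: spec_int_slim_parts hF.
have ssnd : slim (fun n => dsum (fun _ y => y) F E a b (s n) (u n) (s n) (u n)) Q.
  by under eq_fun do rewrite (dsum_snd E pF Fa Fb hsu id); exact: spec_int_slim_parts hQ.
(* The integral of 1 / s is identified with alpha(W): its sums invert those of s and are bounded by
   a^-1. *)
have sfstV : slim (fun n => dsum (fun x _ => x^-1) F E a b (s n) (u n) (s n) (u n)) (alpha W).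
  apply: (slim_inv _ _ _ sfst) => [n|n x|].
  - apply: (dsum_mulV pF pE FE Fa Fb Ea Eb hsu) => x y hx _.
    by rewrite mulVf// gt_eqF// pos.
  - apply: (@dsum_bound _ _ _ _ pF pE FE _ _ Fa Fb Ea Eb _ _ hsu _ a^-1).
      by rewrite invr_ge0 ltW.
    move=> x' _ hx' _; rewrite gtr0_norm ?invr_gt0 ?pos// lef_pV2 ?posrE ?a0 ?pos//.
    by case/andP: hx'.
  - by rewrite /alpha -(conjM UU') QW conj1.
have ssndV : slim (fun n => dsum (fun _ y => y^-1) F E a b (s n) (u n) (s n) (u n)) W.
  apply: (slim_inv _ _ QW ssnd) => [n|n x].
  - apply: (dsum_mulV pF pE FE Fa Fb Ea Eb hsu) => x y _ hy.
    by rewrite mulVf// gt_eqF// pos.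
  - apply: (@dsum_bound _ _ _ _ pF pE FE _ _ Fa Fb Ea Eb _ _ hsu _ a^-1).
      by rewrite invr_ge0 ltW.
    move=> _ y' _ hy'; rewrite gtr0_norm ?invr_gt0 ?pos// lef_pV2 ?posrE ?a0 ?pos//.
    by case/andP: hy'.
have gVg n : dsum g F E a b (s n) (u n) (s n) (u n) *
    dsum (fun x y => (g x y)^-1) F E a b (s n) (u n) (s n) (u n) = 1.
  apply: (dsum_mulV pF pE FE Fa Fb Ea Eb hsu) => x y hx hy.
  by rewrite mulfV// gt_eqF// g_gt0.
exists Q', W'; split; first split.
- apply: slim_psd sQ' => n; apply: (dsum_psd pF pE FE Fa Fb Ea Eb hsu) => x y hx hy.
  by rewrite ltW// g_gt0.
- apply/esym; apply: slim_unique (slim_cst 1) _.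
  have := slimM (fun n x => dsum_bound pF pE FE Fa Fb Ea Eb hsu n x (ltW b0) g_norm) sQ' sW'.
  under eq_fun do rewrite gVg; exact.
- move=> C CQ CaQ; apply: slim_comm sQ' => n; apply: dsum_comm => r; last exact: bE.
  by apply: comm_unconj => //; apply: bE; exact: unconj_comm.
- apply: slim_le sQ' (slimD (slimZ (1 - lam) sfst) (slimZ lam ssnd)) => n.
  rewrite -(dsum_lin _ _ _ _ s u); apply: (dsum_le pF pE FE Fa Fb Ea Eb hsu) => x y hx hy.
  by apply: perspective_le; exact: pos.
- apply: slim_le sW' (slimD (slimZ (1 - lam) sfstV) (slimZ lam ssndV)) => n.
  rewrite -(dsum_lin _ _ _ _ s u); apply: (dsum_le pF pE FE Fa Fb Ea Eb hsu) => x y hx hy.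
  by apply: perspectiveV_le; exact: pos.
- by exists E, a, b.
Qed.

End AluthgeStep.

(** * The iteration and its limit *)

Section Iteration.
Variables (R : realType) (H : hilbertSpace R).
Variables (U U' : bop H).
Hypotheses (UU' : U * U' = 1) (U'U : U' * U = 1).
Hypothesis Uadj : forall x y, rdot (U x) y = rdot x (U' y).
Variables (f : R -> R) (lam : R).
Hypothesis f_cont : forall x, 0 < x -> {for x, continuous f}.
Hypothesis lam01 : 0 < lam < 1.
Hypothesis f_bound : forall t, 0 < t ->
  (1 - lam + lam * t^-1)^-1 <= f t <= 1 - lam + lam * t.
Implicit Types (A B C Q W P : bop H).

Let alpha := conj U U'.

(** The invariant of the iteration. All k occur because alpha^k(Q') is built from alpha^k(Q) and
    alpha^(k+1)(Q), so each step consumes one more power of alpha. *)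
Definition centered_pair Q W :=
  [/\ psd Q, Q * W = 1, forall k, GRing.comm Q (iter k alpha Q) & Q <=o alpha Q].

Lemma iter_alpha_le A B k : A <=o B -> iter k alpha A <=o iter k alpha B.
Proof. by elim: k => // k IH AB; apply: conj_le => //; exact: IH. Qed.

Lemma alpha1 : alpha 1 = 1.
Proof. exact: conj1. Qed.

(** Q' <= alpha(Q) comes from the arithmetic bound and Q <= alpha(Q). The harmonic bound and
    alpha(W) <= W give W' <= W, whose inverse is Q <= Q'. Then Q' <= alpha(Q) <= alpha(Q') renews
    the invariant. *)
Lemma centered_step Q W : centered_pair Q W -> exists Q' W',
  [/\ centered_pair Q' W', aluthge_dint U U' f Q Q', Q <=o Q', Q' <=o alpha Q & 
      W' <=o W /\ W' <=o (1 - lam) *: alpha W + lam *: W].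
Proof.
move=> [pQ QW cQ QaQ]; have /andP[l0 l1] := lam01.
have [Q' [W' [[pQ' QW'] bQ' Qle Wle QD]]] :=
  aluthge_step UU' U'U Uadj f_cont lam01 f_bound pQ QW (cQ 1).
have aQW : alpha Q * alpha W = 1 by rewrite /alpha -(conjM UU') QW conj1.
have paQ : psd (alpha Q) by exact: conj_psd.
have aWW : alpha W <=o W by exact: psd_inv_le QaQ.
have Q'aQ : Q' <=o alpha Q.
  apply: psd_le_trans Qle _.
  have -> : alpha Q - ((1 - lam) *: alpha Q + lam *: Q) = lam *: (alpha Q - Q).
    by rewrite scalerBl scale1r scalerBr opprD opprB addrA [alpha Q + _]addrC subrK.
  by apply: psdZ => //; exact: ltW.
have W'W : W' <=o W.
  apply: psd_le_trans Wle _.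
  have -> : W - ((1 - lam) *: alpha W + lam *: W) = (1 - lam) *: (W - alpha W).
    rewrite opprD addrCA [(1 - lam) *: _ in RHS]scalerBr addrC.
    by rewrite [in RHS](scalerBl _ _ W) scale1r.
  by apply: psdZ => //; rewrite subr_ge0 ltW.
have QQ' : Q <=o Q'.
  have sQ := psd_sa pQ; have sQ' := psd_sa pQ'.
  have sW := psd_sa (psd_inv pQ QW); have sW' := psd_sa (psd_inv pQ' QW').
  apply: (psd_inv_le _ _ _ _ W'W).
  - exact: psd_inv QW'.
  - exact: psd_inv QW.
  - exact: sa_inv_comm QW'.
  - exact: sa_inv_comm QW.
exists Q', W'; split => //; split => //.
- move=> k; have ck j : GRing.comm (iter j alpha Q) Q' .
    apply: bQ'; first exact/commr_sym/cQ.
    case: j => [|j]; first exact: (cQ 1).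
    by apply: conj_comm => //; exact/commr_sym/cQ.
  have gen i C : GRing.comm C (iter i alpha Q) -> GRing.comm C (iter i.+1 alpha Q) ->
      GRing.comm C (iter i alpha Q').
    elim: i C => [|i IH] C h1 h2 /=; first exact: bQ'.
    by apply: comm_unconj => //; apply: IH; exact: unconj_comm.
  by apply: gen; apply: commr_sym; exact: ck.
- by apply: psd_le_trans Q'aQ _; exact: conj_le.
Qed.

Lemma aluthge_iteration P W0 : centered_pair P W0 -> exists Q : nat -> bop H,
  [/\ Q 0%N = P, forall n, psd (Q n), forall n, exists Wn, Q n * Wn = 1,
      forall n, GRing.comm (Q n) (alpha (Q n)) /\ aluthge_dint U U' f (Q n) (Q n.+1)
    & exists L, slim (fun n => iter n alpha P) L /\ slim Q L].
Proof.
move=> cP; have /andP[l0 l1] := lam01.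
(* The step is made total, with the identity as default off the invariant, so that choice provides a
   map to iterate. *)
have ex (X : bop H * bop H) : exists Y : bop H * bop H, centered_pair X.1 X.2 ->
    [/\ centered_pair Y.1 Y.2, aluthge_dint U U' f X.1 Y.1, X.1 <=o Y.1, Y.1 <=o alpha X.1 &
      Y.2 <=o X.2 /\ Y.2 <=o (1 - lam) *: alpha X.2 + lam *: X.2].
  have [cX|ncX] := pselect (centered_pair X.1 X.2); last by exists X.
  by have [Q' [W' h]] := centered_step cX; exists (Q', W').
have [G hG] := choice ex.
pose Q n := (iter n G (P, W0)).1; pose W n := (iter n G (P, W0)).2.
have cQ n : centered_pair (Q n) (W n).
  by elim: n => // n IH; have [] := hG _ IH.
have step n : [/\ centered_pair (Q n.+1) (W n.+1), aluthge_dint U U' f (Q n) (Q n.+1),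
    Q n <=o Q n.+1, Q n.+1 <=o alpha (Q n) &
    W n.+1 <=o W n /\ W n.+1 <=o (1 - lam) *: alpha (W n) + lam *: W n].
  exact: hG (cQ n).
exists Q; split => //.
- by move=> n; case: (cQ n).
- by move=> n; exists (W n); case: (cQ n).
- by move=> n; split; [case: (cQ n) => _ _ /(_ 1) | case: (step n)].
have [pP PW _ PaP] := cP.
(* alpha fixes scalars, so P <= c bounds every alpha^n(P). *)
have [c c0 Pc] := sa_bound (psd_sa pP).
have mono n : iter n alpha P <=o iter n.+1 alpha P.
  by rewrite iterSr; exact: iter_alpha_le.
have [||n|L hL] := @vigier _ _ (fun n => iter n alpha P) c%:B.
- exact: psd_sa.
- exact: mono.
- elim: n => //= n IH; have := conj_le Uadj IH.
  by rewrite conjZ [conj _ _ 1]alpha1.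
have monoL n : iter n alpha P <=o L.
  apply: (slim_le _ (slim_cst _) (slim_comp (fun k => leq_addl n k) hL)) => k.
  elim: k => [|k IH]; first by rewrite addn0 subrr; exact: psd0.
  by rewrite addnS; exact: psd_le_trans IH (mono _).
have QP n : Q n <=o iter n alpha P.
  elim: n => [|n IH]; first by rewrite subrr; exact: psd0.
  by have [_ _ _ h _] := step n; apply: psd_le_trans h _; exact: conj_le.
have QL n : Q n <=o L by apply: psd_le_trans (QP n) (monoL n).
have pQ n : psd (Q n) by case: (cQ n).
have pW n : psd (W n) by case: (cQ n) => p e _ _; exact: psd_inv e.
have [||n|M hM] := @vigier _ _ Q L.
- exact: psd_sa.
- by move=> n; case: (step n).
- exact: QL.
have [||n|V hV] := @vigier_decr _ _ W 0.
- exact: psd_sa.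
- by move=> n; case: (step n) => _ _ _ _ [].
- by rewrite subr0.
have sL : sa L by apply: slim_sa hL => n; apply: psd_sa; elim: n => //= n; exact: conj_psd.
have [K K0 LK] := sa_bound sL.
(* The identity Q_n W_n = 1 passes to the strong limit because Q_n <= L <= K is uniformly
   bounded. *)
have MV : M * V = 1.
  apply/esym; apply: slim_unique (slim_cst 1) _.
  have := slimM (fun n x => psd_bound x (pQ n) (psd_le_trans (QL n) LK) (ltW K0)) hM hV.
  have QW n : Q n * W n = 1 by case: (cQ n).
  by under eq_fun do rewrite QW; exact.
have pM : psd M by exact: slim_psd hM.
have pV : psd V by exact: slim_psd hV.
have aV : alpha V = V.
  apply: psd_antisym.
    have h : V <=o (1 - lam) *: alpha V + lam *: V.
      have haV := slim_conj U U' hV.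
      apply: slim_le (slim_comp leqnSn hV)
        (slimD (slimZ (1 - lam) haV) (slimZ lam hV)) => n.
      by case: (step n) => _ _ _ _ [].
    have e : alpha V - V = (1 - lam)^-1 *: ((1 - lam) *: alpha V + lam *: V - V).
      have -> : (1 - lam) *: alpha V + lam *: V - V = (1 - lam) *: (alpha V - V).
        by rewrite scalerBr [(1 - lam) *: V]scalerBl scale1r opprB addrA.
      by rewrite scalerA mulVf ?scale1r// subr_eq0 gt_eqF.
    by rewrite e; apply: psdZ => //; rewrite invr_ge0 subr_ge0 ltW.
  apply: (slim_le _ (slim_conj _ _ hV) hV) => n; have [pn QW _ h] := cQ n.
  apply: (psd_inv_le pn _ QW _ h); first exact: conj_psd.
  by rewrite -(conjM UU') QW conj1.
(* Both alpha(M) and M invert V = alpha(V). *)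
have aM : alpha M = M.
  have VM := sa_inv_comm (psd_sa pM) (psd_sa pV) MV.
  rewrite -[LHS]mulr1 -VM mulrA -[in X in _ * X * _]aV /alpha -(conjM UU') MV.
  by rewrite conj1// mul1r.
have PM : P <=o M.
  apply: (slim_le _ (slim_cst P) hM); elim=> [|n IH]; first by rewrite subrr; exact: psd0.
  by apply: psd_le_trans IH _; case: (step n).
have aPM n : iter n alpha P <=o M.
  by elim: n => //= n IH; rewrite -aM; exact: conj_le.
have LM : L = M.
  by apply: psd_antisym; [exact: slim_le QL hM (slim_cst L) | exact: slim_le aPM hL (slim_cst M)].
by exists L; split=> //; rewrite LM.
Qed.

End Iteration.

(** * Translation to the complex inner product and the stated definitions *)

Section ComplexForms.
Variables (R : realType) (H : hilbertSpace R).
Implicit Types (A B S : bop H) (x y : H) (E : R -> bop H).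

Lemma sa_hdot A x y : sa A -> hdot H (A x) y = hdot H x (A y).
Proof. by move=> sA; rewrite !hdotE !sA linearZ. Qed.

Lemma psd_hdot A x : sa A -> hdot H (A x) x = (rdot (A x) x)%:C.
Proof.
move=> sA; rewrite hdotE; congr (_ +i* _)%C.
have : hdot H (A x) x = Num.conj (hdot H (A x) x).
  by rewrite {1}sa_hdot// hermC expr0 mul1r.
by rewrite hdotE => -[]; lra.
Qed.

Lemma psd_positive A : psd A -> positive A.
Proof.
move=> [sA pA]; split=> [|x]; first exact: bfun_BH.
by rewrite psd_hdot// ler0c.
Qed.

(** <A x, x> is real for all x; expanding its zero imaginary part at x - i y gives the symmetry of
    A. *)
Lemma positive_psd A : positive A -> psd A.
Proof.
move=> [_ pA].
have im0 x : rdot (A x) ('i *: x) = 0.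
  by have := pA x; rewrite hdotE lecE /= => /andP[/eqP ->].
have rdoti x y : rdot ('i *: x) ('i *: y) = rdot x y.
  rewrite /rdot linearZl_LR linearZr_LR /=; case: (hdot H x y) => a b /=; ring.
have rdotil x y : rdot ('i *: x) y = - rdot x ('i *: y).
  rewrite /rdot linearZl_LR linearZr_LR /=; case: (hdot H x y) => a b /=; ring.
split=> [x y|x]; last by have := pA x; rewrite hdotE lecE /= => /andP[].
have := im0 (x - 'i *: y); rewrite scalerBr scalerA -expr2 sqr_i scaleN1r opprK.
rewrite linearB linearZ /= !(rdotDl, rdotDr, rdotNl) rdoti rdotil !im0.
by rewrite (rdotC (A y)); lra.
Qed.

Lemma ople_psd A B : sa A -> sa B -> ople A B -> A <=o B.
Proof.
move=> sA sB h; split=> [|x]; first exact: saB.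
by rewrite bopBE rdotBl subr_ge0 -lecR -!psd_hdot.
Qed.

Lemma psd_ople A B : sa A -> sa B -> A <=o B -> ople A B.
Proof. by move=> sA sB h x; rewrite !psd_hdot// lecR; exact: psd_le_rdot. Qed.

Lemma hdot_inj x y : (forall z, hdot H z x = hdot H z y) -> x = y.
Proof. by move=> h; apply: rdot_inj => z; rewrite rdotC [RHS]rdotC /rdot h. Qed.

Lemma adj_unique (A B : H -> H) : BH B ->
  (forall x y, hdot H (A x) y = hdot H x (B y)) -> adj A = B.
Proof.
move=> bB h; apply: xget_unique; first by split.
move=> C [_ hC]; apply/funext => y; apply: hdot_inj => x.
by rewrite -h -hC.
Qed.

Lemma opsqrt_sqr S : psd S -> opsqrt (S \o S) = S.
Proof.
move=> pS; apply: xget_unique; first by split; [exact: psd_positive|].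
move=> Q [pQ QQ]; have := pQ.1; move=> bQ.
have -> // : Q = Bop bQ by [].
congr bfun; apply: sqrt_unique => //; first exact: positive_psd.
by apply: bopP => x; exact: (congr1 (@^~ x) QQ).
Qed.

Lemma normC_le (e : R) x y : (`|x| <= e%:C * `|y|) = (hn x <= e * hn y).
Proof. by rewrite !hnC -rmorphM lecR. Qed.

Lemma stieltjesE E a b s (u : nat -> R) x :
  \sum_(i < size s) (u i)%:C *: increment (fun t => E t : H -> H) a b s i x =
  stieltjes E a b s u x.
Proof. by rewrite /stieltjes bop_sumE. Qed.

Section RawFamily.
Variable E : R -> bop H.

Lemma spectral_family_projfam : spectral_family (fun t => E t : H -> H) ->
  projfam E /\ right_cont E.
Proof.
move=> [hE mE rE _ _]; have sE s : sa (E s).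
  by move=> x y; have [_ _ h] := hE s; rewrite /rdot h.
have iE s : E s * E s = E s.
  by apply: bopP => x; have [_ h _] := hE s; exact: (congr1 (@^~ x) h).
split; first split=> // s t st.
  (* E s (1 - E t) = 0, since y = (1 - E t) x has <E s y, y> <= <E t y, y> = 0. *)
  apply/eqP; rewrite eq_sym -subr_eq0 -{1}[E s]mulr1 -mulrBr; apply/eqP.
  apply: bopP => x; rewrite bopME; set y := (1 - E t) x.
  have Ety : E t y = 0 by rewrite /y -bopME mulrBr mulr1 iE subrr.
  apply: rdot_le0; rewrite sE -bopME iE rdotC.
  by have := psd_le_rdot y (ople_psd (sE _) (sE _) (mE _ _ st)); rewrite Ety rdot0l.
move=> s x hx; apply/eqP; rewrite -subr_eq0 -hn_eq0 eq_le hn_ge0 andbT.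
apply/ler_addgt0Pr => e e0; rewrite add0r.
have /cvgrPdist_le/(_ e%:C) := rE s x; rewrite ltcR => /(_ e0) h.
have [t [/= st]] := filter_ex (filterI (nbhs_right_gt s) h).
by rewrite (hx t st) hnC lecR.
Qed.

Lemma projfam_spectral_family a b : projfam E -> right_cont E ->
  E a = 0 -> E b = 1 -> spectral_family (fun t => E t : H -> H).
Proof.
move=> pE rE Ea Eb; have sE := projfam_sa pE; have iE := projfam_idem pE; split.
- move=> s; split; first exact: bfun_BH.
  + by apply/funext => x /=; rewrite -bopME iE.
  + by move=> x y; exact: sa_hdot.
- move=> s t st; apply: psd_ople => //; apply: psd_proj; first exact: inc_sa.
  exact: inc_idem.
(* The projections E (s + 1 / (n + 1)) decrease to some G with E t G = G for all t > s. Algebraic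
   right continuity gives E s G = G, while E s G = E s by monotonicity, so G = E s. *)
- move=> s x; pose r n : R := s + n.+1%:R^-1.
  have rs n : s < r n by rewrite ltrDl invr_gt0.
  have rr n : r n.+1 <= r n by rewrite lerD2l lef_pV2 ?posrE// ler_nat.
  have [||n|G hG] := @vigier_decr _ _ (fun n => E (r n)) 0.
  + exact: sE.
  + move=> n; apply: psd_proj; first exact: inc_sa.
    exact: inc_idem.
  + by rewrite subr0; apply: psd_proj.
  have EG t : s < t -> E t * G = G.
    move=> st; have ts : 0 < t - s by rewrite subr_gt0.
    have hr n : r (n + Num.bound (t - s)^-1)%N <= t.
      rewrite /r -lerBrDl -[leRHS]invrK lef_pV2 ?posrE ?invr_gt0//.
      rewrite (le_trans (ltW (archi_boundP _))) ?invr_ge0 ?ltW//.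
      by rewrite ltr_nat ltnS leq_addl.
    have h := slim_comp (fun n => leq_addr (Num.bound (t - s)^-1) n) hG.
    apply: (slim_unique _ h); have := slimMl (E t) h.
    by under eq_fun do rewrite (projfam_minr pE (hr _)).
  have EsG : E s = G.
    have <- : E s * G = G.
      apply: bopP => z; rewrite bopME; apply: rE => t st; by rewrite -bopME EG.
    apply: slim_unique (slim_cst _) _; have := slimMl (E s) hG.
    by under eq_fun do rewrite (projfam_minl pE (ltW (rs _))).
  apply/cvgrPdist_le => e e0.
  have eR : e = (complex.Re e)%:C by rewrite RRe_real// gtr0_real.
  have [|N /(_ N (leqnn _)) hN] := hG x (complex.Re e); first by move: e0; rewrite eR ltcR.
  apply: filterS (filterI (nbhs_right_gt s) (nbhs_right_lt (rs N))) => t [/= st tr].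
  rewrite hnC eR lecR hnBC; apply: le_trans hN.
  rewrite -EsG -(projfam_minr pE (ltW st)) -{1}(projfam_minl pE (ltW tr)).
  (* For s < t < r N the difference at t is E t applied to the difference at r N, and E t is a
     contraction. *)
  have -> : (E t * E (r N)) x - (E t * E s) x = E t (E (r N) x - E s x).
    by rewrite !bopME linearB.
  have -> : E (r N) x - (E t * E s) x = E (r N) x - E s x.
    by rewrite (projfam_minr pE (ltW st)).
  exact: proj_contract.
- move=> x; apply: cvg_near_cst; apply: filterS (nbhs_ninfty_le (num_real a)) => t ta.
  by rewrite -(projfam_minl pE ta) Ea mulr0.
- move=> x; apply: cvg_near_cst; apply: filterS (nbhs_pinfty_ge (num_real b)) => t bt.
  by rewrite -[E t]mul1r -Eb projfam_minl// Eb.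
Qed.

Lemma spectral_decompositionP (P : bop H) a b :
  spectral_decomposition P (fun t => E t : H -> H) a b <-> specdec P E a b.
Proof.
split.
- move=> [sf ab Ea Eb hP]; have [pE rE] := spectral_family_projfam sf.
  split=> //.
    by split; apply: bopP => x; [rewrite Ea | rewrite Eb].
  move=> e e0; have [d d0 hd] := hP e e0; exists d => // s u hsu x.
  by have := hd s u hsu x; rewrite stieltjesE normC_le.
- move=> [pE rE ab [Ea Eb] hP]; split=> //.
  + exact: projfam_spectral_family Ea Eb.
  + by rewrite Ea.
  + by rewrite Eb.
  + move=> e e0; have [d d0 hd] := hP e e0; exists d => // s u hsu x.
    by rewrite stieltjesE normC_le; exact: hd.
Qed.

End RawFamily.

(** An increment D satisfies D U = U (U^-1 D U), which pulls U out of every term. *)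
Lemma double_sumE (phi : R -> R -> R) E (U U' : bop H) a b
    s (u : nat -> R) t (v : nat -> R) x : U * U' = 1 ->
  \sum_(i < size s) \sum_(j < size t) (phi (u i) (v j))%:C *:
    increment (fun r => E r : H -> H) a b s i
      (U (increment (fun r => E r : H -> H) a b t j x)) =
  U (dsum phi (conj U U' \o E) E a b s u t v x).
Proof.
move=> UU'; rewrite -bopME /dsum mulr_sumr bop_sumE; apply: eq_bigr => i _.
rewrite mulr_sumr bop_sumE; apply: eq_bigr => j _.
rewrite -bopZAr bopZE; congr (_ *: _).
have -> : binc (conj U U' \o E) a b s i = conj U U' (binc E a b s i) by rewrite conjB.
by rewrite /conj !mulrA UU' mul1r.
Qed.

End ComplexForms.

(** * Evaluation of the induced Aluthge transform *)

Section InducedAluthge.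
Variables (R : realType) (H : hilbertSpace R).
Variables (U U' : bop H).
Hypotheses (UU' : U * U' = 1) (U'U : U' * U = 1).
Hypothesis Uadj : forall x y, rdot (U x) y = rdot x (U' y).
Implicit Types (P Q W : bop H) (x y : H).

Lemma hdot_unitary x y : hdot H (U x) y = hdot H x (U' y).
Proof. by rewrite !hdotE !Uadj linearZ. Qed.

Lemma hdot_unitary_inv x y : hdot H (U' x) y = hdot H x (U y).
Proof. by rewrite -{2}[x]/((1 : bop H) x) -UU' bopME hdot_unitary -bopME U'U. Qed.

Lemma unitaryVK x : U' (U x) = x.
Proof. by rewrite -bopME U'U. Qed.

Lemma adj_unitary : adj U = U'.
Proof. by apply: adj_unique; [exact: bfun_BH | exact: hdot_unitary]. Qed.

Lemma adj_unitary_psd Q : psd Q -> adj (U \o Q) = Q \o U'.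
Proof.
move=> pQ; apply: adj_unique; first exact: (bfun_BH (Q * U')).
by move=> x y /=; rewrite hdot_unitary sa_hdot//; exact: psd_sa.
Qed.

Lemma adj_psd_unitary Q : psd Q -> adj (Q \o U') = U \o Q.
Proof.
move=> pQ; apply: adj_unique; first exact: (bfun_BH (U * Q)).
by move=> x y /=; rewrite sa_hdot ?hdot_unitary_inv//; exact: psd_sa.
Qed.

Lemma opabs_unitary_psd Q : psd Q -> opabs (U \o Q) = Q.
Proof.
move=> pQ; rewrite /opabs adj_unitary_psd//.
rewrite (_ : _ \o _ = Q \o Q); first exact: opsqrt_sqr.
by apply/funext => x /=; rewrite unitaryVK.
Qed.

(** The modulus of the adjoint of U Q is U Q U^-1, so semi-hyponormality is an inequality between Q
    and its conjugate. *)
Lemma opabs_psd_unitary Q : psd Q -> opabs (Q \o U') = unconj U U' Q.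
Proof.
move=> pQ; rewrite /opabs adj_psd_unitary//.
have pS : psd (unconj U U' Q).
  by apply: (@conj_psd _ _ U' U) => // x y; rewrite rdotC -Uadj rdotC.
rewrite -[RHS]opsqrt_sqr//; congr opsqrt.
by apply/funext => x /=; rewrite unitaryVK.
Qed.

Lemma polar_unitary_psd Q W : psd Q -> Q * W = 1 -> polar_decomposition (U \o Q) U.
Proof.
move=> pQ QW; have sQ := psd_sa pQ; have sW := psd_sa (psd_inv pQ QW).
have WQ := sa_inv_comm sQ sW QW.
split.
- exact: bfun_BH.
- by rewrite opabs_unitary_psd.
- by rewrite adj_unitary; apply/funext => x /=; rewrite unitaryVK.
- move=> x /=; split=> [Ux|UQx].
    by rewrite -[x]unitaryVK Ux !linear0.
  have Qx : Q x = 0 by rewrite -[Q x]unitaryVK UQx linear0.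
  by rewrite -[x]/((1 : bop H) x) -WQ bopME Qx !linear0.
Qed.

Lemma iter_conj P n x : iter n (conj U U') P x = iter n U' (P (iter n U x)).
Proof.
elim: n x => // n IH x; rewrite [iter n.+1 U x]iterSr /=.
by rewrite -IH.
Qed.

Variables (f : R -> R) (lam : R).
Hypothesis f_cont : forall t, 0 < t -> {for t, continuous f}.
Hypothesis lam01 : 0 < lam < 1.
Hypothesis f_bound : forall t, 0 < t ->
  (1 - lam + lam * t^-1)^-1 <= f t <= 1 - lam + lam * t.

(** The value chosen by [xget] is forced: invertibility of Q fixes the polar factor,
    [specdec_unique] fixes the spectral family, and integrals with different end points agree by
    [dsum_compare]. *)
Lemma induced_AluthgeE Q W Q' : psd Q -> Q * W = 1 ->
  GRing.comm Q (conj U U' Q) -> aluthge_dint U U' f Q Q' ->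
  induced_Aluthge f (U \o Q) = U \o Q'.
Proof.
move=> pQ QW QaQ [E [a [b [dec FE hQ']]]].
have polU := polar_unitary_psd pQ QW.
apply: xget_unique.
  exists U, (fun t => E t : H -> H), a, b; split=> //.
    by rewrite opabs_unitary_psd//; exact/spectral_decompositionP.
  move=> e e0; have [d d0 hd] := hQ' e e0; exists d => // s u t v hs ht x.
  rewrite (double_sumE (fun s t => s * f (t / s)) E a b s u t v x UU').
  rewrite normC_le -(linearB U) (hn_unitary U'U Uadj).
  exact: hd.
move=> S [V [E1 [a1 [b1 [[_ TV _ _] dec1 hS]]]]].
rewrite opabs_unitary_psd// in TV dec1.
have {TV}VU : V = U.
  apply/funext => x; have := congr1 (@^~ (W x)) TV => /=.
  by rewrite -(bopME Q) QW.
rewrite {V}VU in hS.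
have [E2 EE1] : exists E2 : R -> bop H, E1 = (fun t => E2 t).
  have bE t : BH (E1 t) by case: dec1 => -[/(_ t)[]].
  by exists (fun t => Bop (bE t)).
move: dec1 hS; rewrite {}EE1 => /spectral_decompositionP dec1.
have EE2 := specdec_unique dec1 dec; rewrite {}EE2 in dec1 * => hS.
have [pE _ /andP[a0 ab] [Ea Eb] _] := dec.
have [_ _ /andP[a10 ab1] [Ea1 Eb1] _] := dec1.
set F := conj U U' \o E in hQ'; have pF : projfam F by exact: conj_projfam.
have F0 r : E r = 0 -> F r = 0 by rewrite /F /= => ->; rewrite conj0.
have F1 r : E r = 1 -> F r = 1 by rewrite /F /= => ->; rewrite conj1.
(* A common square containing the tags of both decompositions. *)
set m := Num.min a a1; set M := Num.max b b1.
have mM : 0 < m < M by rewrite lt_min a0 a10 /= lt_max gt_min ab.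
have uc := perspective_uc f_cont lam01 f_bound mM.
apply/funext => x; apply/eqP; rewrite -subr_eq0 -hn_eq0 eq_le hn_ge0 andbT /=.
(* One e for each Riemann sum and one for the comparison of the two sums. *)
suff h e : 0 < e -> hn (S x - U (Q' x)) <= (e + e + e) * hn x.
  have [x0|x0] := eqVneq (hn x) 0; first by have := h 1 ltr01; rewrite x0 mulr0.
  have {}x0 : 0 < hn x by rewrite lt_def x0 hn_ge0.
  rewrite -(@pmulr_lle0 _ (hn x)^-1) ?invr_gt0//; apply/ler_addgt0Pr => e e0.
  rewrite add0r ler_pdivrMr//; have := h (e / 3); rewrite divr_gt0// => /(_ isT).
  by rewrite (_ : e / 3 + e / 3 + e / 3 = e)//; field.
move=> e0; have [d d0 hd] := uc e e0.
have [d1 d10 hd1] := hS e e0; have [d2 d20 hd2] := hQ' e e0.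
have m1 : 0 < Num.min d1 (d / 2) by rewrite lt_min d10 divr_gt0.
have m2 : 0 < Num.min d2 (d / 2) by rewrite lt_min d20 divr_gt0.
have [s1 [u1 h1]] := tagged_partition_exists ab1 m1.
have [s2 [u2 h2]] := tagged_partition_exists ab m2.
have h1d : tagged_partition a1 b1 d1 s1 u1.
  by apply: tagged_partition_mono h1; rewrite ge_min lexx.
have h1d' : tagged_partition a1 b1 (d / 2) s1 u1.
  by apply: tagged_partition_mono h1; rewrite ge_min lexx orbT.
have h2d : tagged_partition a b d2 s2 u2.
  by apply: tagged_partition_mono h2; rewrite ge_min lexx.
have h2d' : tagged_partition a b (d / 2) s2 u2.
  by apply: tagged_partition_mono h2; rewrite ge_min lexx orbT.
have := hd1 _ _ _ _ h1d h1d x; rewrite normC_le.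
rewrite (double_sumE (fun s t => s * f (t / s)) E a1 b1 s1 u1 s1 u1 x UU').
rewrite -/F; set X1 := dsum _ _ _ _ _ _ _ _ _ => b1'.
have := hd2 _ _ _ _ h2d h2d x; set X2 := dsum _ _ _ _ _ _ _ _ _ => b2'.
have b3 : hn (X1 x - X2 x) <= e * hn x.
  apply: (dsum_compare pF pE FE _ (F0 _ Ea1) (F1 _ Eb1) Ea1 Eb1 (F0 _ Ea) (F1 _ Eb) Ea Eb
    _ _ _ _ h1d' h1d' h2d' h2d' (ltW e0) (m := m) (M := M));
    rewrite ?ge_min ?le_max ?lexx ?orbT//.
  by rewrite -splitr.
have -> : S x - U (Q' x) = (S x - U (X1 x)) + U (X1 x - X2 x) + U (X2 x - Q' x).
  by rewrite !linearB /= subrKA subrKA.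
rewrite !mulrDl; apply: le_trans (hnD _ _) _; rewrite lerD//; last first.
  by rewrite (hn_unitary U'U Uadj) hnBC.
by apply: le_trans (hnD _ _) _; rewrite lerD// (hn_unitary U'U Uadj).
Qed.

End InducedAluthge.

Theorem theorem3p3 (R : realType) (H : hilbertSpace R) (T U : H -> H)
    (f : R -> R) (lam : R)
    (Tinv : invertible T) (TU : polar_decomposition T U) (Tcent : centered T U)
    (fmean : representing_function f)
    (flam : is_derive (1 : R) (1 : R) f lam) (lam01 : 0 < lam < 1)
    (fbound : forall t : R, 0 < t ->
       (1 - lam + lam * t^-1)^-1 <= f t <= 1 - lam + lam * t)
    (Tsemi : semi_hyponormal T) :
  exists L : H -> H,
    [/\ BH L,
        strong_cvg (fun n => iter n (adj U) \o opabs T \o iter n U) L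
      & strong_cvg (fun n => iter n (induced_Aluthge f) T) (U \o L)].
Proof.
have [bT [B bB [TB BT]]] := Tinv; have [bU TE UaU kerU] := TU.
have U_inj x : U x = 0 -> x = 0.
  move=> /kerU Tx; rewrite -[x]/(id x) -BT /= Tx.
  exact: (linear0 (Bop bB)).
have U_surj y : y = U (opabs T (B y)).
  by rewrite -[U _]/((U \o opabs T) (B y)) -TE -[LHS]/(id y) -TB.
pose Ub : bop H := Bop bU.
(* [adj U] is a choice with default 0. Were there no adjoint, U = U (adj U) U would vanish; U being
   injective, H would be trivial, and there the identity is an adjoint. *)
have U_adj : BH (adj U) /\ forall x y, hdot H (U x) y = hdot H x (adj U y).
  have [ex|nex] := pselect (exists A, BH A /\ forall x y, hdot H (U x) y = hdot H x (A y)).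
    exact: (xgetPex (fun=> 0) ex).
  have adj0 : adj U = fun=> 0.
    by apply: xgetPN => A hA; apply: nex; exists A.
  have all0 x : x = 0 :> H.
    apply: U_inj; have := congr1 (@^~ x) UaU; rewrite /= adj0 => <-.
    exact: (linear0 Ub).
  by exfalso; apply: nex; exists id; split; [exact: BH1 | move=> x y; rewrite (all0 x) (all0 (U 0))].
pose Ua : bop H := Bop U_adj.1.
have UaK x : Ua (Ub x) = x.
  apply/eqP; rewrite -subr_eq0; apply/eqP; apply: U_inj.
  rewrite -[U _]/(Ub _) linearB /=; apply/eqP; rewrite subr_eq0; apply/eqP.
  exact: (congr1 (@^~ x) UaU).
have UU' : Ub * Ua = 1.
  apply: bopP => y; rewrite bop1E bopME [y]U_surj.
  exact: (congr1 (@^~ (opabs T (B y))) UaU).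
have U'U : Ua * Ub = 1 by apply: bopP => x; rewrite bopME UaK.
have Uadj x y : rdot (Ub x) y = rdot x (Ua y) by rewrite /rdot U_adj.2.
(* If the choice in [opsqrt] falls back on its default, the result is 0, which is positive too. *)
have posP : positive (opabs T).
  have [[S hS]|nex] := pselect (exists S, [set S | positive S /\ S \o S = adj T \o T] S).
    by have [] := xgetPex (fun=> 0) (ex_intro _ S hS).
  have abs0 : opabs T = fun=> 0.
    by apply: xgetPN => S hS; apply: nex; exists S.
  by rewrite abs0; split=> [|x]; [exact: BH0 | rewrite linear0l].
pose P : bop H := Bop posP.1.
have pP : psd P by exact: positive_psd.
have {}TE : T = Ub \o P by exact: TE.
(* U P B U = T B U = U, and U is injective, so B U inverts P. *)
have PW : P * (Bop bB * Ub) = 1.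
  apply: bopP => x; rewrite !bopME bop1E -[LHS]UaK -[RHS]UaK; congr (Ua _).
  rewrite -[Ub (P _)]/((Ub \o P) _) -TE.
  exact: (congr1 (@^~ (U x)) TB).
pose alpha := conj Ub Ua.
have iterE n : iter n (adj U) \o opabs T \o iter n U = iter n alpha P.
  by apply/funext => x; rewrite (iter_conj Ub Ua).
have cP k : GRing.comm P (iter k alpha P).
  case: k => // k; apply: bopP => x.
  have := Tcent (opabs T) (iter k.+1 alpha P).
  move=> h; apply: (congr1 (@^~ x) (h _ _)).
    by left; left.
  by left; right; exists k.+1 => //; rewrite iterE.
(* Semi-hyponormality reads U P U^-1 <= P; applying alpha gives P <= alpha(P). *)
have PaP : P <=o alpha P.
  have -> : P = conj Ub Ua (unconj Ub Ua P) by rewrite unconjK.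
  apply: conj_le => //; rewrite unconjK//.
  apply: ople_psd.
  - by apply: (@conj_sa _ _ Ua Ub) => [x y|]; [rewrite rdotC -Uadj rdotC | exact: psd_sa].
  - exact: psd_sa.
  - have := Tsemi; rewrite /semi_hyponormal {1}TE (adj_unitary_psd Uadj pP).
    by rewrite (opabs_psd_unitary UU' U'U Uadj pP).
have fcont : forall t, 0 < t -> {for t, continuous f} by case: fmean => _ [].
have [Q [Q0 pQ QW stepQ [L [PL QL]]]] :=
  aluthge_iteration UU' U'U Uadj fcont lam01 fbound (And4 pP PW cP PaP).
exists L; split.
- exact: bfun_BH.
- by move=> x; under eq_fun do rewrite iterE; exact/cvto_cvg/PL.
- have TQ n : iter n (induced_Aluthge f) T = Ub \o Q n.
    elim: n => [|n IH]; first by rewrite /= Q0.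
    have [W QnW] := QW n; have [cQ dQ] := stepQ n.
    rewrite iterS IH.
    exact: (induced_AluthgeE UU' U'U Uadj fcont lam01 fbound (pQ n) QnW cQ dQ).
  move=> x; under eq_fun do rewrite TQ.
  exact/cvto_cvg/(cvto_bop Ub)/QL.
Qed.
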